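(* Let $K$ be a totally real number field, $S,\mathcal{C}\subset\mathcal{O}_K^+/\mathcal{U}_K^2$, and $X\in\{\mathrm{cl},\mathrm{nc}\}$. If $\mathcal{C}$ is a generalized $(S,X)$-criterion set, then $\mathcal{C}_S^X\subset\mathcal{C}$. In particular, $\mathcal{C}_S^X$ is the unique inclusion-minimal generalized $(S,X)$-criterion set.
   Context: $K$ totally real, $\mathcal{O}_K$ its ring of integers, $\mathcal{U}_K$ its unit group, $\mathcal{O}_K^+$ the totally positive integers, $\mathcal{O}_K^+/\mathcal{U}_K^2$ the set of classes $\alpha\mathcal{U}_K^2$. A lattice over $K$ is a finitely generated torsion-free $\mathcal{O}_K$-module $L$ with a quadratic map $Q:L\to\mathcal{O}_K$ ($Q(av)=a^2Q(v)$, $B(v,w)=(Q(v+w)-Q(v)-Q(w))/2$ bilinear) with $Q(v)\in\mathcal{O}_K^+$ for $v\ne0$; classical if $B$ is $\mathcal{O}_K$-valued. An $X$-lattice is any lattice for $X=\mathrm{nc}$ and a classical lattice for $X=\mathrm{cl}$. $L$ represents $\alpha$ if $Q(v)=\alpha$ for some $v$; for a set $T$ of classes, $L$ is $T$-universal if it represents every element whose class lies in $T$. A subset $\mathcal{C}\subset\mathcal{O}_K^+/\mathcal{U}_K^2$ (not necessarily contained in $S$) is a generalized $(S,X)$-criterion set if every $X$-lattice is $S$-universal if and only if it is $\mathcal{C}$-universal. $\alpha\in S$ is $(S,X)$-critical if some $X$-lattice does not represent $\alpha$ but is $(S\setminus\{\alpha\})$-universal; $\mathcal{C}_S^X$ is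 the set of all $(S,X)$-critical elements. *)

(* Defs.v *)
From HB Require Import structures.
From mathcomp Require Import all_boot all_order all_algebra all_field.
From mathcomp Require Import boolp classical_sets.

Set Implicit Arguments.
Unset Strict Implicit.
Unset Printing Implicit Defensive.

Import Order.TTheory GRing.Theory Num.Theory.
Local Open Scope classical_set_scope.
Local Open Scope ring_scope.

(* A number field is a [fieldExtType rat]. Its complex embeddings have
   algebraic values, so they are exactly the morphisms to [algC]. *)
Definition totally_real (K : fieldExtType rat) : Prop :=
  forall (s : {rmorphism K -> algC}) (x : K), s x \is Num.real.

Definition integral_elt (K : fieldExtType rat) : {pred K} :=
  fun x => `[< integralOver (intr : int -> K) x >].

Lemma integral_elt_subring (K : fieldExtType rat) :
  subring_closed (@integral_elt K).
Proof.
split=> [|x y /asboolP ix /asboolP iy|x y /asboolP ix /asboolP iy];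
  apply/asboolP.
- exact: (integral1 (intr : {rmorphism int -> K})).
- exact: (integral_sub (RtoK := (intr : {rmorphism int -> K}))).
- exact: (integral_mul (RtoK := (intr : {rmorphism int -> K}))).
Qed.

HB.instance Definition _ (K : fieldExtType rat) :=
  GRing.isSubringClosed.Build K (@integral_elt K) (integral_elt_subring K).

Record integers (K : fieldExtType rat) :=
  Integers { int_val : K; int_valP : int_val \in @integral_elt K }.

HB.instance Definition _ (K : fieldExtType rat) :=
  [isSub for @int_val K].
HB.instance Definition _ (K : fieldExtType rat) :=
  [Choice of integers K by <:].
HB.instance Definition _ (K : fieldExtType rat) :=
  [SubChoice_isSubComNzRing of integers K by <:].

Section Units.
Context (K : fieldExtType rat).
Implicit Types x y : integers K.

Definition integers_unit : {pred integers K} :=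
  fun x => `[< exists y, y * x = 1 >].

Definition integers_inv x : integers K :=
  if pselect (exists y, y * x = 1) is left xu then sval (cid xu) else x.

Lemma integers_mulVx : {in integers_unit, left_inverse 1 integers_inv *%R}.
Proof.
move=> x /asboolP xu; rewrite /integers_inv; case: pselect => // xu'.
exact: svalP (cid xu').
Qed.

Lemma integers_unitPl x y : y * x = 1 -> integers_unit x.
Proof. by move=> yx; apply/asboolP; exists y. Qed.

Lemma integers_invr_out : {in [predC integers_unit], integers_inv =1 id}.
Proof.
move=> x /asboolPn xu; rewrite /integers_inv.
by case: pselect => // xu'; case: xu.
Qed.

End Units.

HB.instance Definition _ (K : fieldExtType rat) :=
  GRing.ComNzRing_hasMulInverse.Build (integers K)
    (@integers_mulVx K) (@integers_unitPl K) (@integers_invr_out K).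

Definition totally_positive (K : fieldExtType rat) (a : integers K) : Prop :=
  forall s : {rmorphism K -> algC}, 0 < s (\val a).

(* The class [a U_K^2], as a set of integers. *)
Definition sqclass (K : fieldExtType rat) (a : integers K) :
    set (integers K) :=
  [set a * u ^+ 2 | u in [set u | u \is a GRing.unit]].

Definition positive_classes (K : fieldExtType rat) : set (set (integers K)) :=
  [set sqclass a | a in [set a | totally_positive a]].

Definition finitely_generated (R : nzRingType) (M : lmodType R) : Prop :=
  exists (n : nat) (e : 'I_n -> M),
    forall v, exists c : 'I_n -> R, v = \sum_(i < n) c i *: e i.

Definition torsion_free (R : nzRingType) (M : lmodType R) : Prop :=
  forall (a : R) (v : M), a *: v = 0 -> a = 0 \/ v = 0.

(* Valued in [K]: it is integral only for classical lattices. *)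
Definition polar (K : fieldExtType rat) (L : lmodType (integers K))
    (Q : L -> integers K) (v w : L) : K :=
  (\val (Q (v + w)) - \val (Q v) - \val (Q w)) / 2.

Record lattice (K : fieldExtType rat) := Lattice {
  lat_carrier :> lmodType (integers K);
  lat_fg : finitely_generated lat_carrier;
  lat_torsion_free : torsion_free lat_carrier;
  lat_Q : lat_carrier -> integers K;
  lat_QZ : forall a v, lat_Q (a *: v) = a ^+ 2 * lat_Q v;
  lat_bilinear : bilinear_for (\val \; *%R) (\val \; *%R) (polar lat_Q);
  lat_pos : forall v, v != 0 -> totally_positive (lat_Q v)
}.

Inductive lattice_kind := cl | nc.

Definition X_lattice (K : fieldExtType rat) (X : lattice_kind)
    (L : lattice K) : Prop :=
  match X with
  | cl => forall v w : L, polar (@lat_Q K L) v w \in @integral_elt K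
  | nc => True
  end.

Definition represents (K : fieldExtType rat) (L : lattice K)
    (a : integers K) : Prop :=
  exists v : L, lat_Q v = a.

Definition universal (K : fieldExtType rat) (T : set (set (integers K)))
    (L : lattice K) : Prop :=
  forall a, totally_positive a -> T (sqclass a) -> represents L a.

Definition gen_criterion_set (K : fieldExtType rat)
    (S : set (set (integers K))) (X : lattice_kind)
    (C : set (set (integers K))) : Prop :=
  C `<=` @positive_classes K /\
  forall L : lattice K, X_lattice X L -> (universal S L <-> universal C L).

Definition min_gen_criterion_set (K : fieldExtType rat)
    (S : set (set (integers K))) (X : lattice_kind)
    (C : set (set (integers K))) : Prop :=
  gen_criterion_set S X C /\
  forall D, gen_criterion_set S X D -> D `<=` C -> D = C.

(* Representation only depends on the class, so any representative [a] of the
   class [c] may be used. *)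
Definition critical (K : fieldExtType rat) (S : set (set (integers K)))
    (X : lattice_kind) : set (set (integers K)) :=
  [set c | S c /\ exists a, [/\ totally_positive a, sqclass a = c &
     exists L : lattice K,
       [/\ X_lattice X L, ~ represents L a & universal (S `\ c) L]]].

(* Main.v *)
Require Import Defs.
From HB Require Import structures.
From mathcomp Require Import all_boot all_order all_algebra all_field.
From mathcomp Require Import boolp classical_sets.
From mathcomp Require Import zify ring lra.

(** Write [N] for the norm. The key point is that for every totally positive [al] there
    is a diagonal classical lattice [M] which represents every totally positive [be]
    with [N be >= N al] outside the class of [al], while all its coefficients have norm
    at least [N al] and lie outside that class. Norms grow under addition of totally
    positive elements, so [L _|_ M] represents [al] only if [L] does. If [L] is not
    [S]-universal and [al] is a class of [S] of least norm missed by [L], then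
    [L _|_ M] shows that [al] is critical; hence the critical classes form a criterion
    set. If [al] is critical by way of [L] and not in a criterion set [C], then
    [L _|_ <al>] is [C]-universal, so an element of [C] missed by [L] has the form
    [Q v + al t^2 + ...] with [t <> 0] and norm at least [N al]; thus [L _|_ M] is
    [C]-universal and misses [al], a contradiction.

    To build [M]: a pigeonhole argument gives units of prescribed archimedean shape, so
    up to unit squares every [be] has all its conjugates comparable to [m] with
    [m^d = N be]. The [be] with [m] small are finitely many. The others are, up to
    finitely many representatives, of the form [be0 + k D l] with fixed integers [k], [D]
    and [l] again balanced, and [D l] is represented by a fixed diagonal form, thanks to
    Lagrange's four square theorem. *)

Set Implicit Arguments.
Unset Strict Implicit.
Unset Printing Implicit Defensive.

Import Order.TTheory GRing.Theory Num.Theory.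
Local Open Scope classical_set_scope.
Local Open Scope ring_scope.

(** * Sums of four squares *)

Definition four_sq (n : int) :=
  exists a b c e : int, n = a ^+ 2 + b ^+ 2 + c ^+ 2 + e ^+ 2.

(** Euler's identity, that is, multiplicativity of the norm of quaternions. *)
Lemma four_sqM m n : four_sq m -> four_sq n -> four_sq (m * n).
Proof.
move=> [a [b [c [e ->]]]] [x [y [z [t ->]]]].
exists (a * x + b * y + c * z + e * t), (a * y - b * x + c * t - e * z),
  (a * z - b * t - c * x + e * y), (a * t + b * z - c * y - e * x); ring.
Qed.

(** The residue is taken with [- m < 2 * y <= m]. Leaving out the end [- m] gives the last clause,
    which serves to exclude [r = m] in the descent. *)
Lemma centered_residue (m x : int) : 0 < m ->
  exists y k : int, x = y + m * k /\ 4 * y ^+ 2 <= m ^+ 2 /\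
    (4 * y ^+ 2 = m ^+ 2 -> m = 2 * y).
Proof.
move=> m0; have h1 := divz_eq (2 * x + m - 1) (2 * m).
have h2 : 0 <= ((2 * x + m - 1) %% (2 * m))%Z by apply: modz_ge0; lia.
have h3 : ((2 * x + m - 1) %% (2 * m))%Z < 2 * m by apply: ltz_pmod; lia.
move: h1 h2 h3; set k := (_ %/ _)%Z; set r := (_ %% _)%Z => h1 h2 h3.
exists (x - m * k), k; set y := x - m * k.
have l : 1 - m <= 2 * y by rewrite /y; lia.
have u : 2 * y <= m by rewrite /y; lia.
split; first by rewrite /y; ring.
by split; nia.
Qed.

(** Lagrange's descent. Centered residues modulo [m] give a sum of four squares [m * r] with
    [r <= m]. In Euler's identity for the product of [m * p] and [m * r] all four terms are
    divisible by [m]; dividing by [m ^ 2] leaves [r * p]. If [r] were [0] or [m], then [m] would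
    divide [p]. *)
Lemma four_sq_descent (m p : nat) : prime p -> (1 < m < p)%N ->
  four_sq (m%:Z * p%:Z) ->
  exists2 r : nat, (0 < r < m)%N & four_sq (r%:Z * p%:Z).
Proof.
move=> pp /andP[m1 mp] [a [b [c [e E]]]].
have m0 : 0 < m%:Z by lia.
have ndvd (z : int) : p%:Z <> m%:Z * z.
  move=> h; have : (m%:Z %| p%:Z)%Z by apply/dvdzP; exists z; rewrite mulrC.
  rewrite dvdzE /= => /(primeP pp).2; lia.
have [y1 [k1 [E1 [B1 C1]]]] := centered_residue a m0.
have [y2 [k2 [E2 [B2 C2]]]] := centered_residue b m0.
have [y3 [k3 [E3 [B3 C3]]]] := centered_residue c m0.
have [y4 [k4 [E4 [B4 C4]]]] := centered_residue e m0.
(* The quotient of [y1 ^ 2 + y2 ^ 2 + y3 ^ 2 + y4 ^ 2] by [m], written without division. *)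
have [r Dr] : exists r, r = p%:Z - 2 * (y1 * k1 + y2 * k2 + y3 * k3 + y4 * k4)
  - m%:Z * (k1 ^+ 2 + k2 ^+ 2 + k3 ^+ 2 + k4 ^+ 2) by eexists.
have Er : m%:Z * r = y1 ^+ 2 + y2 ^+ 2 + y3 ^+ 2 + y4 ^+ 2.
  by rewrite Dr !mulrBr E E1 E2 E3 E4; ring.
have r0 : 0 <= r by rewrite -(pmulr_rge0 _ m0) Er !addr_ge0 ?sqr_ge0.
have rm : r <= m%:Z by rewrite -(ler_pM2l m0) Er; lra.
have rn0 : r != 0.
  apply/eqP => h; have Er0 : m%:Z * r = 0 by rewrite h; exact: mulr0.
  rewrite Er0 in Er.
  have s1 := sqr_ge0 y1; have s2 := sqr_ge0 y2.
  have s3 := sqr_ge0 y3; have s4 := sqr_ge0 y4.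
  have /eqP : y1 ^+ 2 = 0 by lra.
  have /eqP : y2 ^+ 2 = 0 by lra.
  have /eqP : y3 ^+ 2 = 0 by lra.
  have /eqP : y4 ^+ 2 = 0 by lra.
  rewrite !sqrf_eq0 => /eqP z4 /eqP z3 /eqP z2 /eqP z1.
  apply: (ndvd (k1 ^+ 2 + k2 ^+ 2 + k3 ^+ 2 + k4 ^+ 2)).
  by move: h; rewrite Dr z1 z2 z3 z4; lra.
have rnm : r != m%:Z.
  apply/eqP => h; move: Er; rewrite h => Er.
  have /C1 F1 : 4 * y1 ^+ 2 = m%:Z ^+ 2 by lra.
  have /C2 F2 : 4 * y2 ^+ 2 = m%:Z ^+ 2 by lra.
  have /C3 F3 : 4 * y3 ^+ 2 = m%:Z ^+ 2 by lra.
  have /C4 F4 : 4 * y4 ^+ 2 = m%:Z ^+ 2 by lra.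
  apply: (ndvd (1 + (k1 + k2 + k3 + k4) + (k1 ^+ 2 + k2 ^+ 2 + k3 ^+ 2 + k4 ^+ 2))).
  move: h; rewrite Dr; set M := m%:Z in F1 F2 F3 F4 *; move=> h.
  have -> : p%:Z = M + (2 * y1) * k1 + (2 * y2) * k2 + (2 * y3) * k3 + (2 * y4) * k4
     + M * (k1 ^+ 2 + k2 ^+ 2 + k3 ^+ 2 + k4 ^+ 2) by rewrite -{1}h; ring.
  by rewrite -F1 -F2 -F3 -F4; ring.
exists `|r|%N; first by move: r0 rn0 rm rnm; clear; lia.
have -> : `|r|%N%:Z = r by move: r0; clear; lia.
(* The terms of Euler's identity for [(a, b, c, e)] and [(y1, y2, y3, y4)], each divided by [m]. *)
exists (r + (y1 * k1 + y2 * k2 + y3 * k3 + y4 * k4)),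
  (k1 * y2 - k2 * y1 + k3 * y4 - k4 * y3),
  (k1 * y3 - k2 * y4 - k3 * y1 + k4 * y2), (k1 * y4 + k2 * y3 - k3 * y2 - k4 * y1).
have M0 : m%:Z ^+ 2 != 0 by rewrite expf_neq0 // lt0r_neq0.
apply: (mulfI M0).
have -> : m%:Z ^+ 2 * (r * p%:Z) = (m%:Z * r) * (m%:Z * p%:Z) by ring.
have -> : m%:Z ^+ 2 * ((r + (y1 * k1 + y2 * k2 + y3 * k3 + y4 * k4)) ^+ 2 +
   (k1 * y2 - k2 * y1 + k3 * y4 - k4 * y3) ^+ 2 +
   (k1 * y3 - k2 * y4 - k3 * y1 + k4 * y2) ^+ 2 +
   (k1 * y4 + k2 * y3 - k3 * y2 - k4 * y1) ^+ 2) =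
  (m%:Z * r + m%:Z * (y1 * k1 + y2 * k2 + y3 * k3 + y4 * k4)) ^+ 2 +
   (m%:Z * (k1 * y2 - k2 * y1 + k3 * y4 - k4 * y3)) ^+ 2 +
   (m%:Z * (k1 * y3 - k2 * y4 - k3 * y1 + k4 * y2)) ^+ 2 +
   (m%:Z * (k1 * y4 + k2 * y3 - k3 * y2 - k4 * y1)) ^+ 2 by ring.
rewrite E Er E1 E2 E3 E4; ring.
Qed.

Lemma Fp_nat_eq0 (p n : nat) : prime p -> (n%:R == 0 :> 'F_p) = (p %| n)%N.
Proof. by move=> pp; rewrite -(dvdn_pcharf (pchar_Fp pp)). Qed.

Lemma Fp_nat_sq_inj (p : nat) (i j : 'I_(p./2).+1) : prime p -> odd p ->
  (i%:R ^+ 2 == j%:R ^+ 2 :> 'F_p) -> i = j.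
Proof.
move=> pp op; wlog ij : i j / (i <= j)%N.
  move=> h; case/orP: (leq_total i j) => ij; first exact: h.
  by rewrite eq_sym => /(h _ _ ij).
rewrite eq_sym -subr_eq0 subr_sqr -natrB // -natrD -natrM Fp_nat_eq0 // Euclid_dvdM //.
have hi := ltn_ord i; have hj := ltn_ord j; have := odd_double_half p; rewrite op => hp.
case/orP; last first.
  case: (posnP (j + i)) => [h _|h /(dvdn_leq h)]; first by apply: val_inj => /=; lia.
  by rewrite -addnn in hp; lia.
case: (posnP (j - i)) => [h _|h /(dvdn_leq h)]; first by apply: val_inj => /=; lia.
by rewrite -addnn in hp; lia.
Qed.

(** For odd [p], the squares and the elements [-1 - j ^ 2] form two sets of [(p + 1) / 2] residues,
    so they meet. This gives [i ^ 2 + j ^ 2 + 1 = m * p], and [i, j < p / 2] forces [m < p]. *)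
Lemma four_sq_multiple (p : nat) : prime p ->
  exists2 m : nat, (0 < m < p)%N & four_sq (m%:Z * p%:Z).
Proof.
move=> pp; have p2 := prime_gt1 pp.
case: (even_prime pp) => [->|op]; first by exists 1%N => //; exists 1, 1, 0, 0.
have hp := odd_double_half p; rewrite op -addnn in hp.
pose A := [set (i%:R ^+ 2 : 'F_p) | i : 'I_(p./2).+1].
pose B := [set (-1 - i%:R ^+ 2 : 'F_p) | i : 'I_(p./2).+1].
have cA : #|A| = (p./2).+1.
  rewrite card_in_imset ?card_ord // => i j _ _ /eqP; exact: Fp_nat_sq_inj.
have cB : #|B| = (p./2).+1.
  rewrite card_in_imset ?card_ord // => i j _ _ /addrI/oppr_inj/eqP.
  exact: Fp_nat_sq_inj.
have : A :&: B != finset.set0.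
  rewrite -card_gt0 -(ltn_add2l #|A :|: B|) addn0 cardsUI cA cB.
  by apply: (leq_ltn_trans (max_card _)); rewrite card_Fp //; lia.
case/finset.set0Pn => x /finset.setIP[/imsetP[i _ ->] /imsetP[j _] /eqP].
move=> /eqP h.
have : ((i ^ 2 + j ^ 2 + 1)%N%:R == 0 :> 'F_p).
  by rewrite !natrD !natrX h addrNK addNr.
rewrite Fp_nat_eq0 //.
have hi := ltn_ord i; have hj := ltn_ord j.
move=> /dvdnP[m Em]; exists m.
  have : (m * p < p * p)%N by rewrite -Em; nia.
  rewrite ltn_pmul2r; last by lia.
  by move=> ->; rewrite andbT; case: (m) Em => //; rewrite mul0n; lia.
by exists i%:Z, j%:Z, 1, 0; move: Em; lia.
Qed.

Lemma four_sq_prime (p : nat) : prime p -> four_sq p%:Z.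
Proof.
move=> pp; have [m] := four_sq_multiple pp.
elim/ltn_ind: m => m IH /andP[m0 mp] hm.
have [m1|m1] := leqP m 1.
  by have -> : p%:Z = m%:Z * p%:Z by rewrite (_ : m = 1%N) ?mul1r //; lia.
have [|r /andP[r0 rm] hr] := four_sq_descent pp _ hm; first by rewrite m1.
by apply: (IH r rm _ hr); rewrite r0 (ltn_trans rm).
Qed.

Lemma Lagrange_four_sq (n : nat) : four_sq n%:Z.
Proof.
elim/ltn_ind: n => n IH; have [n1|n1] := leqP n 1.
  by exists n%:Z, 0, 0, 0; case: n n1 {IH} => [|[]].
have pn := pdiv_prime n1.
have -> : n%:Z = (pdiv n)%:Z * (n %/ pdiv n)%:Z by rewrite -PoszM mulnC divnK ?pdiv_dvd.
apply: four_sqM; first exact: four_sq_prime.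
by apply: IH; apply: ltn_Pdiv; [apply: prime_gt1 | lia].
Qed.

(** * Real embeddings *)

(** Multiplying [q(x) = 0], of degree [m], by the power [m - 1] of the leading coefficient [a] gives
    a monic equation for [a * x]; its polynomial is [r]. *)
Lemma integral_scale_monic (K : fieldType) (q : {poly int}) (x : K) :
  (lead_coef q)%:~R != 0 :> K -> root (map_poly intr q) x ->
  integralOver (intr : int -> K) ((lead_coef q)%:~R * x).
Proof.
set a := lead_coef q => a0 /eqP qx.
have q0 : q != 0 by apply: contraNneq a0 => h; rewrite /a h lead_coef0.
have [m Em] : exists m, size q = m.+1 by exists (size q).-1; rewrite prednK // size_poly_gt0.
have Ea : q`_m = a by rewrite /a lead_coefE Em.
pose r : {poly int} := \poly_(i < m) (q`_i * a ^+ (m.-1 - i)) + 'X^m.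
have sr := size_poly m (fun i => q`_i * a ^+ (m.-1 - i)).
exists r; first by rewrite monicE lead_coefDr ?lead_coefXn ?size_polyXn ?ltnS.
rewrite /root /r rmorphD /= map_polyXn hornerD hornerXn exprMn.
have -> : map_poly intr (\poly_(i < m) (q`_i * a ^+ (m.-1 - i))) =
   \poly_(i < m) ((q`_i * a ^+ (m.-1 - i))%:~R : K).
  by apply/polyP => i; rewrite coef_map !coef_poly; case: ifP => //; rewrite mulr0z.
rewrite horner_poly.
have qx' : \sum_(i < m) (q`_i)%:~R * x ^+ i + a%:~R * x ^+ m = 0.
  rewrite -[RHS]qx (_ : map_poly intr q = \poly_(i < m.+1) ((q`_i)%:~R : K)); last first.
    apply/polyP => i; rewrite coef_map coef_poly; case: ltnP => // h.
    by rewrite nth_default ?Em.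
  by rewrite horner_poly big_ord_recr /= Ea.
have [m0|m0] := posnP m.
  by move: qx'; rewrite m0 big_ord0 add0r expr0 mulr1 => /eqP; rewrite (negPf a0).
have -> : a%:~R ^+ m * x ^+ m = a%:~R ^+ m.-1 * (a%:~R * x ^+ m) :> K.
  by rewrite mulrA -exprSr prednK.
rewrite (eq_bigr (fun i : 'I_m => a%:~R ^+ m.-1 * ((q`_i)%:~R * x ^+ i))); last first.
  move=> i _; rewrite rmorphM rmorphXn /= exprMn.
  have -> : (m.-1 = (m.-1 - i) + i)%N by rewrite subnK // -ltnS prednK.
  by rewrite addnK exprD; ring.
by rewrite -mulr_sumr -mulrDr qx' mulr0.
Qed.

Section Embeddings.
Variables (K : fieldExtType rat).
Local Notation ev th := (fun q : {poly rat} => (map_poly (in_alg K) q).[th]).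

Lemma map_rat_poly (R : unitRingType) (s : {rmorphism K -> R}) (q : {poly rat}) :
  map_poly s (map_poly (in_alg K) q) = map_poly ratr q.
Proof.
rewrite -map_poly_comp; apply: eq_map_poly => a /=.
by rewrite rmorphZ_num rmorph1 mulr1.
Qed.

Lemma map_horner_rat (R : comUnitRingType) (s : {rmorphism K -> R}) (q : {poly rat}) th :
  s (ev th q) = (map_poly ratr q).[s th].
Proof. by rewrite -horner_map map_rat_poly. Qed.

Lemma integral_multiple (x : K) :
  exists2 a : int, a != 0 & a%:~R * x \in @integral_elt K.
Proof.
have /polyOver1P[p Ep] := minPolyOver 1%AS x.
have [q [a a0 Eq]] := rat_poly_scale p.
have p0 : p != 0.
  apply: contraTneq (monic_minPoly 1%AS x) => h.
  by rewrite Ep h rmorph0 monicE lead_coef0 eq_sym oner_eq0.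
have q0 : q != 0 by apply: contraNneq p0 => h; rewrite Eq h rmorph0 scaler0.
exists (lead_coef q); first by rewrite lead_coef_eq0.
apply/asboolP/integral_scale_monic.
  by rewrite -[_%:~R](rmorph_int (in_alg K)) fmorph_eq0 intr_eq0 lead_coef_eq0.
have := root_minPoly 1%AS x; rewrite Ep Eq linearZ /= rootZ; last first.
  by rewrite -in_algE fmorph_eq0 invr_eq0 intr_eq0.
rewrite -map_poly_comp; congr (root _ x); apply: eq_map_poly => i /=.
exact: (rmorph_int (in_alg K)).
Qed.

Lemma pchar_number_field : [pchar K] =i pred0.
Proof. by move=> i; rewrite pchar_lalg pchar_num. Qed.

(** The primitive element theorem, with the generator multiplied by an integer to make it
    integral. *)
Lemma number_field_generator :
  exists (th : K) (p : {poly rat}),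
  [/\ th \in @integral_elt K, p \is monic /\ (1 < size p)%N, separable_poly p,
      forall x, exists2 q : {poly rat}, (size q < size p)%N & x = ev th q
    & forall q : {poly rat}, ev th q = 0 <-> p %| q].
Proof.
have sepK : separable (1%AS : {subfield K}) fullv.
  by apply/separableP=> u _; apply: pcharf0_separable; exact: pchar_number_field.
have Eth := eq_adjoin_separable_generator sepK (sub1v _).
set th0 := separable_generator _ _ in Eth.
have [a a0 ia] := integral_multiple th0.
set th := a%:~R * th0 in ia.
have a0' : a%:~R != 0 :> rat by rewrite intr_eq0.
have Eth1 : <<1; th>>%VS = fullv.
  apply/eqP; rewrite eqEsubv subvf /= {1}Eth; apply/FadjoinP; split; first exact: subv_adjoin.
  have -> : th0 = (a%:~R : rat)^-1 *: th.
    by rewrite /th -scaler_int mulr_algl scalerA mulVf // scale1r.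
  by rewrite memvZ // memv_adjoin.
have /polyOver1P[p Ep] := minPolyOver 1%AS th.
have sp : size p = size (minPoly 1%AS th) by rewrite Ep size_map_poly.
exists th, p; split => //.
- split; first by have := monic_minPoly 1%AS th; rewrite Ep map_monic.
  by rewrite sp size_minPoly.
- have := pcharf0_separable 1%AS pchar_number_field th.
  by rewrite /separable_element Ep separable_map.
- move=> x; have : x \in <<1; th>>%VS by rewrite Eth1 memvf.
  move=> /Fadjoin1_polyP[q ->]; exists (q %% p).
    by rewrite ltn_modp -size_poly_eq0 sp size_minPoly.
  rewrite {1}(divp_eq q p) rmorphD rmorphM /= hornerD hornerM -Ep minPolyxx mulr0 add0r //.
- move=> q; split=> [h|/dvdpP[r ->]]; last by rewrite rmorphM hornerM /= -Ep minPolyxx mulr0.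
  rewrite -(dvdp_map (in_alg K)) -Ep; apply: minPoly_dvdp; first exact: alg_polyOver.
  by rewrite /root h.
Qed.

(** The embeddings correspond to the roots of the minimal polynomial [p] of a generator [th], and
    total realness puts their values in [algR]. The basis consists of the powers of [th], so the
    matrix is a Vandermonde matrix of distinct conjugates. *)
Lemma real_embeddings (hK : totally_real K) :
  exists (d : nat) (sg : 'I_d -> {rmorphism K -> algR}) (b : 'I_d -> K),
  [/\ (0 < d)%N,
   (forall s : {rmorphism K -> algC}, exists i, forall x, s x = algRval (sg i x)),
   (forall i, b i \in @integral_elt K),
   (\matrix_(i, j) sg j (b i)) \in unitmx &
   forall x, exists c : 'I_d -> rat, x = \sum_i c i *: b i].
Proof.
have [th [p [ith [mp sp] sepp genp kerp]]] := number_field_generator.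
have [rs Ers] := closed_field_poly_normal (map_poly ratr p : {poly algC}).
rewrite lead_coef_map (monicP mp) rmorph1 scale1r in Ers.
have urs : uniq rs.
  by rewrite -separable_prod_XsubC -Ers separable_map.
have srs : size p = (size rs).+1.
  by rewrite -(size_map_poly (@ratr algC)) Ers size_prod_XsubC.
pose q_ x := sval (cid2 (genp x)).
have q_E x : x = ev th (q_ x) by rewrite /q_; case: cid2.
have emb r : r \in rs -> exists s : {rmorphism K -> algR}, algRval (s th) = r.
  move=> rrs; have rp : (map_poly ratr p).[r] = 0.
    by apply/eqP; rewrite -/(root _ _) Ers root_prod_XsubC.
  pose f x : algC := (map_poly ratr (q_ x)).[r].
  (* Any polynomial expression of [x] in [th] may be used to compute [f x], because [p] vanishes at
     [r]; the morphism laws follow. *)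
  have fE x q : x = ev th q -> f x = (map_poly ratr q).[r].
    move=> Ex; apply/eqP; rewrite -subr_eq0 -hornerN -hornerD -rmorphB /=.
    have /kerp/dvdpP[t ->] : ev th (q_ x - q) = 0.
      by rewrite rmorphB hornerD hornerN -q_E -Ex subrr.
    by rewrite rmorphM hornerM rp mulr0.
  have fB : zmod_morphism f.
    by move=> x y; rewrite (fE _ (q_ x - q_ y)) ?rmorphB ?hornerD ?hornerN //= -!q_E.
  have fM : monoid_morphism f.
    split; first by rewrite (fE _ 1) ?rmorph1 ?hornerC.
    by move=> x y; rewrite (fE _ (q_ x * q_ y)) ?rmorphM ?hornerM //= -!q_E.
  pose F : {rmorphism K -> algC} := HB.pack f (GRing.isZmodMorphism.Build _ _ f fB)
     (GRing.isMonoidMorphism.Build _ _ f fM).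
  pose g x : algR := in_algR (hK F x).
  have gB : zmod_morphism g by move=> x y; apply: val_inj; exact: (rmorphB F).
  have gM : monoid_morphism g.
    by split => [|x y]; apply: val_inj; [exact: (rmorph1 F)|exact: (rmorphM F)].
  exists (HB.pack g (GRing.isZmodMorphism.Build _ _ g gB)
     (GRing.isMonoidMorphism.Build _ _ g gM) : {rmorphism K -> algR}).
  rewrite /= /g /= /f -/(f th) (fE _ 'X) ?map_polyX ?hornerX //.
pose d := size rs.
pose sg (i : 'I_d) := sval (cid (emb _ (mem_nth 0 (ltn_ord i)))).
have sgE i : algRval (sg i th) = rs`_i by rewrite /sg; case: cid.
exists d, sg, (fun i => th ^+ i); split.
- by move: sp; rewrite srs ltnS.
- move=> s; have : s th \in rs.
    rewrite -root_prod_XsubC -Ers -(map_rat_poly s) rmorph_root //.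
    by apply/eqP/kerp; rewrite dvdpp.
  case/(nthP 0) => i ir Ei; exists (Ordinal ir) => x.
  rewrite (q_E x) (map_horner_rat s) -Ei -(sgE (Ordinal ir)).
  exact/esym/(map_horner_rat (algRval \o sg (Ordinal ir))).
- by move=> i; rewrite rpredX.
- rewrite (_ : \matrix_(i, j) _ = Vandermonde d (\row_j sg j th)); last first.
    by apply/matrixP=> i j; rewrite !mxE rmorphXn.
  rewrite unitmxE det_Vandermonde unitfE; apply/prodf_neq0 => i _; apply/prodf_neq0 => j ij.
  by rewrite !mxE subr_eq0 -val_eqE /= !sgE nth_uniq // neq_ltn ij orbT.
- move=> x; have [q sq ->] := genp x; exists (fun i => q`_i).
  rewrite horner_coef size_map_poly.
  rewrite (big_ord_widen d (fun i => (map_poly (in_alg K) q)`_i * th ^+ i)); last first.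
    by rewrite -ltnS -srs.
  rewrite big_mkcond; apply: eq_bigr => i _; rewrite coef_map mulr_algl.
  by case: ltnP => // h; rewrite nth_default ?scale0r.
Qed.
End Embeddings.

(** * Finiteness and pigeonhole *)

(** One element of [P] is chosen in each fibre of [f] that meets [P]. *)
Lemma finite_reps (T : eqType) (F : finType) (P : T -> Prop) (f : T -> F) :
  exists s : seq T, (forall y, y \in s -> P y) /\
    forall x, P x -> exists2 y, y \in s & f y = f x.
Proof.
pose g k := if pselect (exists x, P x /\ f x = k) is left e then Some (sval (cid e)) else None.
exists (pmap g (enum F)); split=> [y|x Px].
  rewrite mem_pmap => /mapP[k _]; rewrite /g; case: pselect => // e [->].
  by case: (svalP (cid e)).
have e : exists x', P x' /\ f x' = f x by exists x.
exists (sval (cid e)); last by case: (svalP (cid e)).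
rewrite mem_pmap; apply/mapP; exists (f x); rewrite ?mem_enum // /g.
by case: pselect => [e'|//]; congr (Some (sval (cid _))); apply: Prop_irrelevance.
Qed.

Lemma finite_reps_mod (T : eqType) (n q : nat) (P : T -> Prop) (c : T -> 'rV[int]_n) :
  (0 < q)%N ->
  exists s : seq T, (forall y, y \in s -> P y) /\
    forall x, P x -> exists2 y, y \in s & exists e, c x = c y + q%:Z *: e.
Proof.
case: q => // q _.
pose f x : {ffun 'I_n -> 'I_q.+1} := [ffun i => inord `|(c x 0%R i %% q.+1%:Z)%Z|].
have [s [sP sR]] := finite_reps P f; exists s; split => // x /sR[y ys /ffunP fxy].
exists y => //; exists (\row_i ((c x 0%R i %/ q.+1%:Z)%Z - (c y 0%R i %/ q.+1%:Z)%Z)).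
apply/rowP => i; rewrite !mxE; have := fxy i; rewrite !ffunE => /(congr1 val) /=.
have lt z : (`|(z %% q.+1%:Z)%Z| < q.+1)%N.
  by have := ltz_pmod z (isT : 0 < q.+1%:Z); have := modz_ge0 z (isT : q.+1%:Z != 0); lia.
rewrite !inordK // => E.
have := divz_eq (c x 0 i) q.+1; have := divz_eq (c y 0 i) q.+1.
have := modz_ge0 (c x 0 i) (isT : q.+1%:Z != 0).
have := modz_ge0 (c y 0 i) (isT : q.+1%:Z != 0).
rewrite mulrBr ![_%:Z * _]mulrC; lia.
Qed.

Lemma finite_bounded (T : eqType) (n J : nat) (P : T -> Prop) (c : T -> 'rV[int]_n) :
  injective c -> (forall x, P x -> forall i, `|c x 0 i| <= J%:Z) ->
  exists s : seq T, forall x, x \in s <-> P x.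
Proof.
move=> cI cJ.
pose f x : {ffun 'I_n -> 'I_(J + J).+1} := [ffun i => inord `|c x 0 i + J%:Z|].
have [s [sP sR]] := finite_reps P f; exists s => x; split; first exact: sP.
move=> Px; have [y ys /ffunP fxy] := sR _ Px.
suff -> : x = y by [].
apply/cI/rowP => i; have := fxy i; rewrite !ffunE => /(congr1 val) /=.
have := cJ _ Px i; have := cJ _ (sP _ ys) i => h1 h2.
by rewrite !inordK; lia.
Qed.

Lemma mulmx_bound (R : realDomainType) (n : nat) (A : 'M[R]_n) :
  exists2 B : R, 0 < B & forall (v : 'rV_n) M, (forall i, `|v 0 i| <= M) ->
    forall j, `|(v *m A) 0 j| <= B * M.
Proof.
exists (1 + \sum_i \sum_j `|A i j|).
  by rewrite ltr_pwDl // !sumr_ge0 // => i _; rewrite sumr_ge0.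
move=> v M vM j.
have M0 : 0 <= M by apply: le_trans (vM j); rewrite normr_ge0.
rewrite mxE mulrDl mul1r; apply: (le_trans (ler_norm_sum _ _ _)).
rewrite mulr_suml -[leLHS]add0r lerD // ler_sum // => i _.
rewrite normrM mulrC ler_pM // (bigD1 j) //= lerDl sumr_ge0 //.
Qed.

Lemma ler_all_bound (R : archiRealFieldType) (n : nat) (x : 'I_n -> R) :
  exists2 m : nat, (0 < m)%N & forall i, x i <= m%:R.
Proof.
exists (\sum_i Num.bound (x i)).+1 => // i.
have h : x i <= (Num.bound (x i))%:R.
  have [x0|/ltW x0] := leP 0 (x i); first exact/ltW/archi_boundP.
  exact: (le_trans x0 (ler0n _ _)).
by apply: (le_trans h); rewrite ler_nat (bigD1 i) //= -addnS leq_addr.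
Qed.


Lemma card_ord_lt (L m : nat) : (#|[pred k : 'I_L.+1 | (k < m)%N]| <= m)%N.
Proof.
apply: (@leq_trans #|codom (fun k : 'I_m => inord k : 'I_L.+1)|).
  apply/subset_leq_card/fintype.subsetP => k; rewrite inE => km.
  by apply/codomP; exists (Ordinal km); rewrite /= inord_val.
by rewrite (leq_trans (leq_image_card _ _)) // card_ord.
Qed.

Lemma card_family_lt (n L : nat) (m : 'I_n -> nat) :
  (#|(family (fun i => [pred k : 'I_L.+1 | (k < m i)%N]) : pred {ffun 'I_n -> 'I_L.+1})|
    <= \prod_i m i)%N.
Proof.
rewrite card_family foldrE /image_mem big_map big_enum /=.
by apply: leq_prod => i _; exact: card_ord_lt.
Qed.

(** A form of Minkowski's theorem on linear forms, with a constant depending on [W] alone. The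
    [(h + 1) ^ n] integer points of a cube are sent by [W] into a box cut into cells with sides
    [4 * B * x i]. As the [x i] have product 1, there are at most [h ^ n] cells, so two points share
    a cell, and their difference is the vector sought. *)
Lemma Minkowski_box (R : archiRealFieldType) (n : nat) (W : 'M[R]_n) : (0 < n)%N ->
  exists2 D : R, 0 < D & forall x : 'I_n -> R,
    (forall i, 0 < x i) -> \prod_i x i = 1 ->
    exists2 c : 'rV[int]_n, c != 0 &
      forall i, `|(map_mx intr c *m W) 0 i| <= D * x i.
Proof.
move=> n0; have [B B0 hB] := mulmx_bound W; exists (4 * B); first by rewrite mulr_gt0.
move=> x x0 x1.
(* With [2 * x i <= h], the number [h / (2 * x i)] is at least 1, so that adding 1 to its truncation
   gives at most [h / x i]. *)
have [h h0 hx] := ler_all_bound (fun i => 2 * x i).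
have hR : 0 < h%:R :> R by rewrite ltr0n.
pose pt (f : {ffun 'I_n -> 'I_h.+1}) : 'rV[int]_n := \row_i (f i)%:Z.
pose y f i := (map_mx intr (pt f) *m W) 0 i.
have yB f i : `|y f i| <= B * h%:R.
  by apply: hB => j; rewrite !mxE /= normr_nat ler_nat -ltnS.
pose t f i := (y f i + B * h%:R) / (4 * B * x i).
have den i : 0 < 4 * B * x i by rewrite !mulr_gt0.
have t0 f i : 0 <= t f i.
  by apply: divr_ge0; last exact: ltW; have := yB f i; rewrite ler_norml; lra.
have tle f i : t f i <= h%:R / (2 * x i).
  have E : h%:R / (2 * x i) * (4 * B * x i) = 2 * B * h%:R by field; rewrite lt0r_neq0.
  rewrite ler_pdivrMr // E.
  by have := yB f i; rewrite ler_norml; lra.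
pose nn i := (Num.truncn (h%:R / (2 * x i))).+1.
have tn f i : (Num.truncn (t f i) < nn i)%N.
  rewrite ltnS truncn_le_nat; exact: le_lt_trans (tle f i) (truncnS_gt _).
(* A common bound, which lets the cell indices of all coordinates live in one finite type. *)
pose L := (\sum_i nn i)%N.
have nL i : (nn i <= L)%N by rewrite /L (bigD1 i) //= leq_addr.
pose code f : {ffun 'I_n -> 'I_L.+1} := [ffun i => inord (Num.truncn (t f i))].
have codeE f i : code f i = Num.truncn (t f i) :> nat.
  by rewrite ffunE inordK // ltnS (leq_trans _ (nL i)) // ltnW.
have : ~~ injectiveb code.
  apply/negP => /injectiveP inj.
  have c1 := card_codom inj; rewrite card_ffun !card_ord in c1.
  have : (h.+1 ^ n <= \prod_i nn i)%N.
    rewrite -c1; apply: leq_trans _ (card_family_lt L nn).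
    apply/subset_leq_card/fintype.subsetP.
    move=> _ /codomP[f ->]; apply/familyP => i; rewrite inE codeE; exact: tn.
  apply/negP; rewrite -ltnNge -(ltr_nat R) natr_prod.
  apply: (@le_lt_trans _ _ (h%:R ^+ n)).
    have -> : h%:R ^+ n = \prod_i (h%:R / x i) :> R.
      by rewrite big_split /= prodfV x1 invr1 mulr1 prodr_const card_ord.
    apply: ler_prod => i _; rewrite ler0n /= /nn -natr1.
    have : (Num.truncn (h%:R / (2 * x i)))%:R <= h%:R / (2 * x i).
      by rewrite truncn_le divr_ge0 ?ler0n // mulr_ge0 // ltW.
    have -> : h%:R / x i = 2 * (h%:R / (2 * x i)) by field; rewrite lt0r_neq0.
    suff : 1 <= h%:R / (2 * x i) by lra.
    by rewrite ler_pdivlMr ?mulr_gt0 // mul1r.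
  by rewrite natrX ltr_pXn2r ?nnegrE ?ler0n // ltr_nat.
case/injectivePn => f [g fg /ffunP Efg].
exists (pt f - pt g).
  apply: contra fg; rewrite subr_eq0 => /eqP/rowP E; apply/eqP/ffunP => i.
  by apply: val_inj; have := E i; rewrite !mxE => -[].
move=> i; rewrite map_mxB mulmxBl mxE [X in _ + X]mxE -/(y f i) -/(y g i).
have [tf tf'] := andP (truncn_itv (t0 f i)); have [tg tg'] := andP (truncn_itv (t0 g i)).
have := congr1 val (Efg i); rewrite /= !codeE => E; rewrite E in tf tf'.
have Et : `|t f i - t g i| <= 1.
  by rewrite ler_norml; move: tf tf' tg tg'; rewrite -natr1; lra.
have -> : y f i - y g i = (t f i - t g i) * (4 * B * x i).
  by rewrite /t -mulrBl divfK ?lt0r_neq0 //; ring.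
by rewrite normrM (gtr0_norm (den i)) ler_piMl // ltW.
Qed.

(** The other factors are at most [C], so their product is at most [C ^ n]. *)
Lemma prod1_lower (R : realFieldType) (n : nat) (y : 'I_n -> R) (C : R) : 1 <= C ->
  (forall i, 0 <= y i <= C) -> \prod_i y i = 1 -> forall i, C ^- n <= y i.
Proof.
move=> C1 yC y1 i; have C0 : 0 < C by lra.
rewrite -[leLHS]mul1r ler_pdivrMr ?exprn_gt0 // -y1 (bigD1 i) //=.
have [y0 _] := andP (yC i); apply: ler_wpM2l => //.
apply: (@le_trans _ _ (\prod_(j | j != i) C)); first exact: ler_prod.
rewrite prodr_const ler_weXn2l //.
by apply: leq_trans (max_card _) _; rewrite card_ord.
Qed.

Lemma algR_root (n : nat) (x : algR) : (0 < n)%N -> 0 < x ->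
  exists2 m : algR, 0 < m & m ^+ n = x.
Proof.
move=> n0 x0; have r0 : 0 < n.-root (algRval x) by rewrite rootC_gt0.
exists (in_algR (gtr0_real r0)); first exact: r0.
by apply: val_inj; rewrite rmorphXn /= rootCK.
Qed.

Lemma dvdz_fact (z : int) (A : nat) : z != 0 -> `|z| <= A%:Z -> exists w, (A`!)%:Z = w * z.
Proof.
move=> z0 zA; apply/dvdzP; rewrite dvdzE /=; apply: dvdn_fact; lia.
Qed.

(** * Values of diagonal quadratic forms *)

Fixpoint diag_rep (R : comNzRingType) (s : seq R) (x : R) : Prop :=
  if s is a :: s' then exists t, diag_rep s' (x - a * t ^+ 2) else x = 0.

Section DiagRep.
Variable R : comNzRingType.
Implicit Types (s : seq R) (a x y : R).

Lemma diag_repE s x :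
  diag_rep s x <-> exists v : 'I_(size s) -> R, x = \sum_(i < size s) s`_i * v i ^+ 2.
Proof.
elim: s x => [|a s IH] x /=.
  split=> [->|[v ->]]; last by rewrite big_ord0.
  by exists (fun=> 0); rewrite big_ord0.
split=> [[t /IH[v Ev]]|[v ->]].
  exists (fun i => if unlift ord0 i is Some j then v j else t).
  rewrite big_ord_recl unlift_none /=; move/eqP: Ev; rewrite subr_eq addrC => /eqP ->.
  by congr (_ + _); apply: eq_bigr => i _; rewrite liftK.
exists (v ord0); apply/IH; exists (fun i => v (lift ord0 i)).
by rewrite big_ord_recl /= addrC addKr.
Qed.

Lemma diag_rep0 s : diag_rep s 0.
Proof. by apply/diag_repE; exists (fun=> 0); rewrite big1 // => i _; rewrite expr0n mulr0. Qed.

Lemma diag_rep_cat s1 s2 x y :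
  diag_rep s1 x -> diag_rep s2 y -> diag_rep (s1 ++ s2) (x + y).
Proof.
elim: s1 x => [|a s1 IH] x /=; first by move=> ->; rewrite add0r.
by move=> [t ht] hy; exists t; rewrite addrAC; apply: IH.
Qed.

Lemma diag_rep_mem s a : a \in s -> diag_rep s a.
Proof.
elim: s => //= b s IH; rewrite inE => /orP[/eqP <-|/IH h].
  by exists 1; rewrite expr1n mulr1 subrr; apply: diag_rep0.
by exists 0; rewrite expr0n mulr0 subr0.
Qed.

Lemma diag_rep_mul k s x : diag_rep s x -> diag_rep [seq k * a | a <- s] (k * x).
Proof.
elim: s x => [|a s IH] x /=; first by move=> ->; rewrite mulr0.
by move=> [t /IH h]; exists t; rewrite -mulrA -mulrBr.
Qed.

Lemma diag_rep_sq s x u : diag_rep s x -> diag_rep s (x * u ^+ 2).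
Proof.
move=> /diag_repE[v ->]; apply/diag_repE; exists (fun i => v i * u).
by rewrite mulr_suml; apply: eq_bigr => i _; rewrite -mulrA -exprMn.
Qed.

(** Four equal coefficients absorb any natural multiple, by Lagrange's theorem. *)
Lemma diag_rep_four (n : nat) a : diag_rep (nseq 4 a) (n%:R * a).
Proof.
have [x [y [z [t E]]]] := Lagrange_four_sq n.
exists x%:~R, y%:~R, z%:~R, t%:~R; rewrite /= -[n%:R]/(n%:~R) E.
by rewrite !rmorphD !rmorphXn /=; ring.
Qed.

Lemma diag_rep_flatten (I : Type) (r : seq I) (f : I -> seq R) (g : I -> R) :
  (forall i, diag_rep (f i) (g i)) ->
  diag_rep (flatten [seq f i | i <- r]) (\sum_(i <- r) g i).
Proof.
move=> h; elim: r => [|i r IH] /=; first by rewrite big_nil.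
by rewrite big_cons; apply: diag_rep_cat.
Qed.

End DiagRep.

(** * Balanced totally positive integers *)

Section Balancing.
Variables (K : fieldExtType rat) (d : nat) (sg : 'I_d -> {rmorphism K -> algR})
  (b : 'I_d -> K).
Hypothesis d_gt0 : (0 < d)%N.
Hypothesis b_int : forall i, b i \in @integral_elt K.
Local Notation W := (\matrix_(i, j) sg j (b i)).
Hypothesis W_unit : W \in unitmx.
Hypothesis b_gen : forall x, exists c : 'I_d -> rat, x = \sum_i c i *: b i.
Local Notation O := (integers K).

(** * Norm, trace and integral coordinates *)

Definition nrm (x : K) : algR := \prod_i sg i x.

Lemma nrmM x y : nrm (x * y) = nrm x * nrm y.
Proof. by rewrite -big_split; apply: eq_bigr => i _; rewrite rmorphM. Qed.

Lemma nrm1 : nrm 1 = 1.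
Proof. by rewrite /nrm big1 // => i _; rewrite rmorph1. Qed.

Lemma nrm_eq0 x : (nrm x == 0) = (x == 0).
Proof.
apply/idP/eqP => [|->].
  by case/prodf_eq0 => i _; rewrite fmorph_eq0 => /eqP.
by apply/prodf_eq0; exists (Ordinal d_gt0); rewrite // rmorph0.
Qed.

Lemma Aint_sg (x : K) i : x \in @integral_elt K -> algRval (sg i x) \in Aint.
Proof.
case/asboolP => p mp px; apply: (@root_monic_Aint (map_poly intr p)).
- have := rmorph_root (algRval \o sg i) px; rewrite -map_poly_comp.
  by congr (root _ _); apply: eq_map_poly => z; rewrite /= !rmorph_int.
- exact: monic_map.
- by apply/polyOverP => j; rewrite coef_map /=.
Qed.

(** Integrality can be tested at a single embedding: the minimal polynomial of the conjugate has
    integer coefficients and also annihilates [x]. *)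
Lemma integral_Aint (x : K) i : algRval (sg i x) \in Aint -> x \in @integral_elt K.
Proof.
move=> ax; have /floorpP[p Ep] := ax.
apply/asboolP; exists p.
  have := minCpoly_monic (algRval (sg i x)); rewrite Ep !monicE.
  rewrite lead_coef_map_inj //; last exact: intr_inj.
  by rewrite -[X in _ == X -> _]/(1%:~R) eqr_int.
have := root_minCpoly (algRval (sg i x)); rewrite Ep.
rewrite -(fmorph_root (algRval \o sg i)) -map_poly_comp.
by congr (root _ _); apply: eq_map_poly => z; rewrite /= !rmorph_int.
Qed.

Lemma sg_ratZ i a (x : K) : sg i (a *: x) = ratr a * sg i x.
Proof. exact: rmorphZ_num. Qed.

(** [A] is multiplication by [x] in the generators [b], and [W] diagonalizes it. Its determinant and
    trace show that the norm and the trace are rational. *)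
Lemma mult_matrix (x : K) : exists A : 'M[rat]_d,
  W *m diag_mx (\row_j sg j x) = map_mx ratr A *m W.
Proof.
pose c i := sval (cid (b_gen (x * b i))).
have cE i : x * b i = \sum_j c i j *: b j by rewrite /c; case: cid.
exists (\matrix_(i, j) c i j); apply/matrixP => i j.
rewrite mul_mx_diag !mxE mulrC -rmorphM /= cE rmorph_sum; apply: eq_bigr => k _.
by rewrite !mxE sg_ratZ.
Qed.

Lemma algR_int (z : algR) : (exists a : rat, z = ratr a) -> algRval z \in Aint ->
  exists n : int, z = n%:~R.
Proof.
move=> [a ->] az.
have : (ratr a : algC) \in Num.int.
  by apply: Cint_rat_Aint; rewrite ?Crat_rat // -(fmorph_rat algRval).
rewrite Cint_rat => /intrP[n ->]; exists n; by rewrite rmorph_int.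
Qed.

Lemma nrm_int (x : K) : x \in @integral_elt K -> exists z : int, nrm x = z%:~R.
Proof.
move=> ix; apply: algR_int.
  have [A EA] := mult_matrix x; exists (\det A).
  have := congr1 determinant EA; rewrite !det_mulmx det_diag det_map_mx mulrC.
  have := W_unit; rewrite unitmxE unitfE => /mulIf I h.
  by rewrite -(I _ _ h); apply: eq_bigr => i _; rewrite mxE.
rewrite /nrm rmorph_prod rpred_prod // => i _; exact: Aint_sg.
Qed.

Lemma trace_int (x : K) : x \in @integral_elt K -> exists z : int, \sum_i sg i x = z%:~R.
Proof.
move=> ix; apply: algR_int.
  have [A EA] := mult_matrix x; exists (\tr A).
  transitivity (\tr (W *m diag_mx (\row_j sg j x) *m invmx W)).
    by rewrite mxtrace_mulC mulKmx // mxtrace_diag; apply: eq_bigr => i _; rewrite mxE.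
  by rewrite EA mulmxK // trace_map_mx.
rewrite rmorph_sum rpred_sum // => i _; exact: Aint_sg.
Qed.

Definition bO i : O := Integers (b_int i).

(** Parametrizes the [Z]-span of [b], which may be smaller than the ring of integers; [discriminant]
    bounds the defect. *)
Definition phi (c : 'rV[int]_d) : O := \sum_i (c 0 i)%:~R * bO i.

Lemma val_intr (z : int) : \val (z%:~R : O) = z%:~R.
Proof. exact: (rmorph_int (\val : {rmorphism O -> K})). Qed.

Lemma phiB c e : phi (c - e) = phi c - phi e.
Proof. by rewrite -sumrB; apply: eq_bigr => i _; rewrite !mxE rmorphB mulrBl. Qed.

Lemma phiD c e : phi (c + e) = phi c + phi e.
Proof. by rewrite -big_split; apply: eq_bigr => i _; rewrite !mxE rmorphD mulrDl. Qed.

Lemma phiZ z e : phi (z *: e) = z%:~R * phi e.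
Proof. by rewrite mulr_sumr; apply: eq_bigr => i _; rewrite !mxE rmorphM mulrA. Qed.

Definition sO i : O -> algR := sg i \o \val.
HB.instance Definition _ i := GRing.RMorphism.on (sO i).

Lemma sO_inj i : injective (sO i).
Proof. by move=> x y /(fmorph_inj (sg i)) /val_inj. Qed.

Lemma sO_phi i c : sO i (phi c) = (map_mx intr c *m W) 0 i.
Proof.
rewrite rmorph_sum mxE; apply: eq_bigr => j _.
by rewrite rmorphM /= rmorph_int !mxE.
Qed.

Lemma phi_coord_bound : exists2 B : algR, 0 < B &
  forall c (M : algR), (forall i, `|sO i (phi c)| <= M) -> forall j, `|(c 0 j)%:~R| <= B * M.
Proof.
have [B B0 h] := mulmx_bound (invmx W); exists B => // c M cM j.
have := h (map_mx intr c *m W) M _ j; rewrite mulmxK // mxE; apply => i.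
by rewrite -sO_phi.
Qed.

Lemma phi_inj : injective phi.
Proof.
move=> c e h; have [B _ hB] := phi_coord_bound.
apply/rowP => j; apply/eqP; rewrite -subr_eq0.
have := hB (c - e) 0 _ j; rewrite mulr0 normr_le0 !mxE intr_eq0; apply => i.
by rewrite phiB h subrr rmorph0 normr0.
Qed.

(** [D] is the absolute value of the determinant of the trace matrix [T] of [b]. The traces of the
    [x * b j] are integers and equal the rational coordinates of [x] times [T]; multiplying by the
    adjugate of [T] makes the coordinates of [\det T * x] integral. *)
Lemma discriminant : exists2 D : nat, (0 < D)%N &
  forall x : O, exists c, D%:R * x = phi c.
Proof.
have tz i j := trace_int (rpredM (b_int i) (b_int j)).
pose T := \matrix_(i, j) sval (cid (tz i j)).
have ET : map_mx intr T = W *m W^T.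
  apply/matrixP => i j; rewrite !mxE; case: cid => z /= <-.
  by apply: eq_bigr => k _; rewrite !mxE rmorphM.
have T0 : \det T != 0.
  rewrite -(intr_eq0 algR) -(det_map_mx intr) ET det_mulmx det_tr mulf_neq0 //.
    by rewrite -unitfE -unitmxE.
  by rewrite -unitfE -unitmxE.
have key (x : O) : exists c, (\det T)%:~R * x = phi c.
  have tx j := trace_int (rpredM (int_valP x) (b_int j)).
  pose t := \row_j sval (cid (tx j)).
  have [c Ec] := b_gen (\val x).
  have Ex : map_mx intr t = (\row_i (ratr (c i) : algR)) *m map_mx intr T.
    apply/rowP => j; rewrite ET mulmxA !mxE; case: cid => z /= <-.
    apply: eq_bigr => k _; rewrite !mxE rmorphM; congr (_ * _).
    by rewrite Ec rmorph_sum; apply: eq_bigr => i _; rewrite !mxE sg_ratZ.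
  exists (t *m \adj T).
  have i0 := Ordinal d_gt0; apply: (@sO_inj i0); rewrite sO_phi map_mxM Ex.
  rewrite map_mx_adj -[_ *m _ *m \adj _]mulmxA mul_mx_adj mul_mx_scalar -scalemxAl mxE.
  rewrite rmorphM /= rmorph_int det_map_mx; congr (_ * _).
  transitivity (sg i0 (\val x)) => //.
  by rewrite Ec rmorph_sum mxE; apply: eq_bigr => i _; rewrite !mxE sg_ratZ.
exists `|\det T|%N; first by rewrite absz_gt0.
move=> x; have [c Ec] := key x.
exists (Num.sg (\det T) *: c); rewrite phiZ -Ec mulrA -rmorphM /= -abszEsg //.
Qed.

Lemma W_phi c i : (map_mx intr c *m W) 0 i = sO i (phi c).
Proof. by rewrite sO_phi. Qed.

(** At one embedding the quotient is the product of the other conjugates of [x], an algebraic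
    integer. *)
Lemma cofactor_integral (x : O) (z : int) : x != 0 -> nrm (\val x) = z%:~R ->
  z%:~R / \val x \in @integral_elt K.
Proof.
move=> x0 Ez; pose i0 := Ordinal d_gt0; apply: (@integral_Aint _ i0).
have -> : sg i0 (z%:~R / \val x) = \prod_(i | i != i0) sO i x.
  rewrite fmorph_div rmorph_int -Ez /nrm (bigD1 i0) //= mulrC mulKf //.
  by rewrite fmorph_eq0.
by rewrite rmorph_prod rpred_prod // => i _; apply/Aint_sg/int_valP.
Qed.

Lemma phi_eq0 c : (phi c == 0) = (c == 0).
Proof.
have p0 : phi 0 = 0 by rewrite -[0]/(0 : 'rV[int]_d) -(subrr 0) phiB subrr.
by rewrite -[X in _ == X]p0 (inj_eq phi_inj).
Qed.

Lemma nrm_O (x : O) : exists z : int, nrm (\val x) = z%:~R.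
Proof. exact/nrm_int/int_valP. Qed.

Lemma nrm_unit (u : O) : u \is a GRing.unit -> `|nrm (\val u)| = 1.
Proof.
case/unitrPr => v uv; have [zu Eu] := nrm_O u; have [zv Ev] := nrm_O v.
have : nrm (\val u) * nrm (\val v) = 1 by rewrite -nrmM -rmorphM uv rmorph1 nrm1.
rewrite Eu Ev -rmorphM -[1]/(1%:~R) => /intr_inj h.
have /eqP := congr1 absz h; rewrite abszM muln_eq1 => /andP[/eqP zu1 _].
by rewrite -intr_norm -abszE zu1.
Qed.

(* The quotient is [1 + (A`! / N c') * phi e * (N c' / phi c')], where the last factor,
   the product of the other conjugates of [phi c'], is integral. *)
Lemma congruent_quotient (A : nat) (c c' e : 'rV[int]_d) :
  c = c' + (A`!)%:Z *: e -> c' != 0 -> `|nrm (\val (phi c'))| <= A%:R ->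
  \val (phi c) / \val (phi c') \in @integral_elt K.
Proof.
move=> -> c0 cA; have x0 : phi c' != 0 by rewrite phi_eq0.
have v0 : \val (phi c') != 0 by rewrite (raddf_eq0 _ val_inj).
have [z Ez] := nrm_O (phi c').
have z0 : z != 0 by rewrite -(intr_eq0 algR) -Ez nrm_eq0.
have [w Ew] : exists w, (A`!)%:Z = w * z.
  apply: dvdz_fact => //; move: cA; rewrite Ez -intr_norm -[A%:R]/(A%:Z%:~R).
  by rewrite ler_int.
rewrite phiD phiZ rmorphD rmorphM /= mulrDl divff // rpredD ?rpred1 //.
rewrite val_intr Ew rmorphM /=.
rewrite (_ : _ / _ = w%:~R * int_val (phi e) * (z%:~R / int_val (phi c'))); last by ring.
by rewrite rpredM ?cofactor_integral // rpredM ?int_valP ?rpred_int.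
Qed.

(** A substitute for Dirichlet's unit theorem. [Minkowski_box] gives an element of norm at most [A]
    whose conjugates are at most [D1 * x i]. Modulo [A!] there are finitely many such elements, and
    congruent ones divide each other, so the quotient by a representative is a unit. The upper
    bounds and norm 1 imply the lower bounds. *)
Lemma balancing_unit : exists2 C : algR, 1 <= C &
  forall x : 'I_d -> algR, (forall i, 0 < x i) -> \prod_i x i = 1 ->
  exists2 u : O, u \is a GRing.unit &
    forall i, C ^- d * x i <= `|sO i u| <= C * x i.
Proof.
have [D1 D0 hD] := Minkowski_box W d_gt0.
have [A _ hA] := ler_all_bound (fun _ : 'I_d => D1 ^+ d).
have {}hA : D1 ^+ d <= A%:R := hA (Ordinal d_gt0).
pose P (c : 'rV[int]_d) := c != 0 /\ `|nrm (\val (phi c))| <= A%:R.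
have [s [sP sR]] := finite_reps_mod P id (fact_gt0 A).
pose E := \sum_(c <- s) \sum_i `|sO i (phi c)|^-1.
have Ec0 c : 0 <= \sum_i `|sO i (phi c)|^-1 by apply: sumr_ge0 => i _; rewrite invr_ge0.
have E0 : 0 <= E by apply: sumr_ge0.
have hE c i : c \in s -> `|sO i (phi c)|^-1 <= E.
  move=> cs; rewrite /E (big_rem c) //= (bigD1 i) //= -addrA lerDl.
  by rewrite addr_ge0 // sumr_ge0 // => j _; rewrite invr_ge0.
exists (1 + D1 * E); first by rewrite lerDl mulr_ge0 // ltW.
set C := 1 + D1 * E.
have C1 : 1 <= C by rewrite lerDl mulr_ge0 // ltW.
move=> x x0 x1; have [c c0 hc] := hD x x0 x1.
have hc' i : `|sO i (phi c)| <= D1 * x i by rewrite -W_phi.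
have cP : P c.
  split=> //; apply: le_trans hA; rewrite /nrm normr_prod.
  have Dd : D1 ^+ d = \prod_(i < d) D1 by rewrite prodr_const card_ord.
  rewrite -[leRHS]mulr1 -[X in _ <= _ * X]x1 Dd -big_split /=.
  by apply: ler_prod => i _; rewrite normr_ge0 hc'.
have [c' c's [e Ec]] := sR _ cP; have [c'0 c'A] := sP _ c's.
have ne (a : 'rV[int]_d) : a != 0 -> \val (phi a) != 0.
  by move=> a0; rewrite (raddf_eq0 _ val_inj) phi_eq0.
have iu := congruent_quotient Ec c'0 c'A.
(* The congruence is symmetric and both norms are at most [A], so the inverse quotient is integral
   too. *)
have Ec' : c' = c + (A`!)%:Z *: (- e) by rewrite Ec scalerN addrK.
have iv := congruent_quotient Ec' c0 cP.2.
pose u : O := Integers iu; pose v : O := Integers iv.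
have vu : v * u = 1.
  by apply: val_inj; rewrite /= mulrA divfK ?ne // divff // ne.
have Nu : `|nrm (\val u)| = 1 by apply: nrm_unit; apply/unitrPr; exists v; rewrite mulrC.
exists u; first by apply/unitrPr; exists v; rewrite mulrC.
have up i : `|sO i u| <= C * x i.
  rewrite /sO /= fmorph_div normrM normfV mulrDl mul1r.
  have h1 := hc' i; have h2 := hE _ i c's.
  have h3 : D1 * x i * E <= D1 * E * x i by rewrite mulrAC.
  apply: (@le_trans _ _ (D1 * E * x i)); last by rewrite lerDr ltW.
  by apply: le_trans h3; apply: ler_pM => //; rewrite invr_ge0.
pose y i := `|sO i u| / x i.
have yC i : 0 <= y i <= C by rewrite divr_ge0 ?(ltW (x0 i)) //= ler_pdivrMr.
have y1 : \prod_i y i = 1.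
  by rewrite big_split /= prodfV x1 invr1 mulr1 -normr_prod.
by move=> i; rewrite up andbT -ler_pdivlMr // (prod1_lower C1 yC).
Qed.

(** * Totally positive integers up to unit squares *)

Definition tpos (x : O) := forall i, 0 < sO i x.

Lemma nrm_O_gt0 x : tpos x -> 0 < nrm (\val x).
Proof. by move=> x0; apply: prodr_gt0 => i _; exact: x0. Qed.

(** A unit whose conjugates have size about [Num.sqrt (m / sO i x)] brings all conjugates of
    [x * u ^+ 2] close to [m]. These prescribed sizes have product 1 because [m ^+ d] is the norm of
    [x]. *)
Lemma balanced_class : exists c C : algR, [/\ 0 < c, 0 < C &
  forall (x : O) m, tpos x -> 0 < m -> m ^+ d = nrm (\val x) ->
  exists2 u : O, u \is a GRing.unit &
    forall i, c * m <= sO i (x * u ^+ 2) <= C * m].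
Proof.
have [C C1 hC] := balancing_unit; have C0 : 0 < C by lra.
exists ((C ^- d) ^+ 2), (C ^+ 2); split; rewrite ?exprn_gt0 ?invr_gt0 ?exprn_gt0 //.
move=> x m x0 m0 Em; pose y i := Num.sqrt (m / sO i x).
have y0 i : 0 < y i by rewrite sqrtr_gt0 divr_gt0.
have y2 i : y i ^+ 2 = m / sO i x by rewrite sqr_sqrtr // ltW // divr_gt0.
have y1 : \prod_i y i = 1.
  apply/eqP; rewrite -(@pexpr_eq1 _ _ 2) ?prodr_ge0 //; last by move=> i _; exact: ltW.
  rewrite -prodrXl (eq_bigr _ (fun i _ => y2 i)) big_split /= prodfV.
  by rewrite prodr_const card_ord Em divff // gt_eqF // nrm_O_gt0.
have [u uu hu] := hC y y0 y1; exists u => // i.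
have -> : sO i (x * u ^+ 2) = sO i x * `|sO i u| ^+ 2.
  by rewrite rmorphM rmorphXn /= real_normK ?num_real.
have Em' : m = sO i x * y i ^+ 2 by rewrite y2 mulrC divfK // gt_eqF.
have [h1 h2] := andP (hu i).
have a0 : 0 < C ^- d by rewrite invr_gt0 exprn_gt0.
rewrite {}Em' !(mulrCA _ (sO i x)) !ler_pM2l // -!exprMn.
by rewrite !ler_sqr ?nnegrE ?mulr_ge0 ?(ltW (y0 i)) ?(ltW a0) ?(ltW C0) ?h1.
Qed.

Lemma sO_nat i (n : nat) : sO i n%:R = n%:R.
Proof. by rewrite rmorph_nat. Qed.

(* [l] is rounded to a square [s^2] plus a rational integer [m'] of size comparable to
   [m]; the error has size [O(sqrt m)], so [m'] absorbs it into the cone spanned by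
   [1] and the totally positive [p + b j], [p - b j]. *)
Lemma large_balanced_rep (c C : algR) (D : nat) : 0 < c -> 0 < C ->
  (forall x : O, exists e, D%:R * x = phi e) -> (0 < D)%N ->
  exists (M : algR) (s : seq O), (forall a, a \in s -> tpos a) /\
    forall (l : O) (m : algR), M <= m -> (forall i, c * m <= sO i l <= C * m) ->
    diag_rep s (D%:R * l).
Proof.
move=> c0 C0 hD D0.
have [E E0 hE] := mulmx_bound W.
have [B B0 hB] := phi_coord_bound.
have [p0 _ hp0] := ler_all_bound (fun i => \sum_j `|sg i (b j)|).
pose p := p0.+1.
have hp i j : `|sg i (b j)| < p%:R.
  apply: (@le_lt_trans _ _ p0%:R); last by rewrite ltr_nat.
  by apply: le_trans (hp0 i); rewrite (bigD1 j) //= lerDl sumr_ge0.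
pose G := p%:R * d%:R * B * E.
have G0 : 0 <= G by rewrite !mulr_ge0 ?ler0n // ltW.
(* Chosen to give [G * (2 * Y + E) <= m'] below: the [1] pays for the truncation in [m'], the other
   terms for [G * E] and for the AM-GM remainder. *)
pose M := 4 / c * (1 + G * E + 4 * G ^+ 2 * C / c).
have M0 : 0 <= M.
  by rewrite mulr_ge0 ?divr_ge0 ?addr_ge0 ?mulr_ge0 ?sqr_ge0 ?invr_ge0 // ltW.
(* [D] serves for [D * s ^+ 2], the four ones for the remaining natural number, and the elements
   [p + b j] or [p - b j] for the coordinate [e 0 j] of the error, according to its sign. *)
exists M, (D%:R :: nseq 4 1 ++
  flatten [seq nseq 4 (p%:R + bO j) ++ nseq 4 (p%:R - bO j) | j <- enum 'I_d]).
split.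
  move=> a; rewrite inE mem_cat mem_nseq => /or3P[/eqP->|/andP[_ /eqP->]|].
  - by move=> i; rewrite sO_nat ltr0n.
  - by move=> i; rewrite rmorph1.
  case/flatten_mapP => j _; rewrite mem_cat !mem_nseq /= => /orP[]/eqP-> i.
    rewrite rmorphD /= sO_nat /sO /=; have := hp i j; rewrite ltr_norml; lra.
  rewrite rmorphB /= sO_nat /sO /=; have := hp i j; rewrite ltr_norml; lra.
move=> l m Mm hl; have m0 : 0 <= m := le_trans M0 Mm.
pose m' := Num.truncn (c * m / 2).
have cm0 : 0 <= c * m / 2 by rewrite divr_ge0 // mulr_ge0 // ltW.
have [m'1 m'2] := andP (truncn_itv cm0); rewrite -/m' in m'1 m'2; rewrite -(natr1 m') in m'2.
pose y i := Num.sqrt (sO i l - m'%:R); pose Y := Num.sqrt (C * m).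
have Y0 : 0 <= Y := sqrtr_ge0 _.
have Y2 : Y ^+ 2 = C * m by rewrite sqr_sqrtr // mulr_ge0 // ltW.
have lm i : 0 <= sO i l - m'%:R by have := hl i; move: m'1; lra.
have y0 i : 0 <= y i := sqrtr_ge0 _.
have y2 i : y i ^+ 2 = sO i l - m'%:R by rewrite sqr_sqrtr.
have yY i : y i <= Y.
  by apply: ler_wsqrtr; have := hl i; have := ler0n algR m'; lra.
have [z zW] : exists z, z *m W = \row_i y i.
  by exists ((\row_i y i) *m invmx W); rewrite mulmxKV.
(* Rounding the real coordinates gives an element [s] within [E] of the square root [y i] of
   [l - m'] at every embedding. *)
pose q := \row_j Num.floor (z 0 j).
pose s := phi q.
have sy i : `|sO i s - y i| <= E.
  have -> : sO i s - y i = ((map_mx intr q - z) *m W) 0 i.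
    by rewrite mulmxBl zW [in RHS]mxE -sO_phi !mxE.
  rewrite -[leRHS]mulr1; apply: hE => j; rewrite !mxE.
  have := floor_itv (z 0 j); rewrite rmorphD /= => /andP[].
  by rewrite ler_norml; lra.
have [ep El] : exists ep, l = ep + s ^+ 2 + m'%:R.
  by exists (l - s ^+ 2 - m'%:R); ring.
have [e Ee] := hD ep.
have epB i : `|sO i (phi e)| <= D%:R * (E * (2 * Y + E)).
  rewrite -Ee rmorphM /= sO_nat normrM normr_nat ler_wpM2l ?ler0n //.
  have -> : sO i ep = (y i - sO i s) * (y i + sO i s).
    by rewrite -subr_sqr y2 El !rmorphD rmorphXn /= sO_nat; ring.
  rewrite normrM distrC; apply: ler_pM => //.
  have := sy i; have := yY i; have := y0 i; rewrite !ler_norml; lra.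
have eB j : `|(e 0 j)%:~R| <= B * (D%:R * (E * (2 * Y + E))) := hB e _ epB j.
(* Replacing each [e 0 j * b j] by [|e 0 j|] copies of [p + b j] or [p - b j] costs [p * S] in all,
   to be taken from [D * m']. *)
pose S := (\sum_j `|e 0%R j|)%N.
have SB : S%:R <= d%:R * (B * (D%:R * (E * (2 * Y + E)))) :> algR.
  rewrite natr_sum -[X in X%:R * _]card_ord -sum1_card natr_sum mulr_suml.
  apply: ler_sum => j _; rewrite mul1r; apply: le_trans (eB j).
  by rewrite -intr_norm -abszE.
have Gm : G * (2 * Y + E) <= m'%:R.
  have h1 : 1 + G * E + 4 * G ^+ 2 * C / c <= c * m / 4.
    have -> : c * m / 4 = m / (4 / c) by field; rewrite lt0r_neq0.
    by rewrite ler_pdivlMr ?divr_gt0 // mulrC.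
  (* AM-GM: [2 G Y <= c Y^2 / (4 C) + 4 G^2 C / c] *)
  have h2 : 2 * G * Y <= c * m / 4 + 4 * G ^+ 2 * C / c.
    have -> : c * m / 4 = c / (4 * C) * Y ^+ 2 by rewrite Y2; field; rewrite lt0r_neq0.
    have h3 : 0 <= c / (4 * C) * (Y - 4 * G * C / c) ^+ 2.
      by rewrite mulr_ge0 ?sqr_ge0 // divr_ge0 ?mulr_ge0 // ltW.
    have h4 : c / (4 * C) * (Y - 4 * G * C / c) ^+ 2 =
       c / (4 * C) * Y ^+ 2 + 4 * G ^+ 2 * C / c - 2 * G * Y.
      by field; rewrite !lt0r_neq0.
    lra.
  lra.
have pS : (p * S <= D * m')%N.
  rewrite -(ler_nat algR) !natrM.
  apply: (@le_trans _ _ (D%:R * (G * (2 * Y + E)))); last by rewrite ler_wpM2l.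
  have -> : D%:R * (G * (2 * Y + E)) =
     p%:R * (d%:R * (B * (D%:R * (E * (2 * Y + E))))) by rewrite /G; ring.
  by rewrite ler_wpM2l.
have -> : D%:R * l = D%:R * s ^+ 2 + ((D * m' - p * S)%N%:R * 1 +
    \sum_(j <- enum 'I_d) (`|e 0%R j|%N%:R * (p%:R + (Num.sg (e 0 j))%:~R * bO j))).
  rewrite {1}El !mulrDr Ee big_enum /= natrB // !natrM.
  have -> : \sum_j (`|e 0%R j|%N%:R * (p%:R + (Num.sg (e 0 j))%:~R * bO j)) =
     p%:R * S%:R + phi e.
    rewrite natr_sum mulr_sumr -big_split; apply: eq_bigr => j _ /=.
    rewrite mulrDr mulrC; congr (_ + _); rewrite mulrA; congr (_ * _).
    by rewrite pmulrn -intrM abszE mulrC -numEsg.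
  ring.
exists s; rewrite addrC addKr.
apply: diag_rep_cat; first exact: diag_rep_four.
apply: diag_rep_flatten => j.
case: (ltgtP (e 0 j) 0) => h.
- rewrite ltr0_sg // mulN1r -[_ * _]add0r; apply: diag_rep_cat; first exact: diag_rep0.
  exact: diag_rep_four.
- rewrite gtr0_sg // mul1r -[_ * _]addr0; apply: diag_rep_cat; last exact: diag_rep0.
  exact: diag_rep_four.
- by rewrite h mul0r; exact: diag_rep0.
Qed.

Lemma tposM x y : tpos x -> tpos y -> tpos (x * y).
Proof. by move=> x0 y0 i; rewrite rmorphM; apply: mulr_gt0; [apply: x0|apply: y0]. Qed.

Lemma tpos_nat (n : nat) : (0 < n)%N -> tpos n%:R.
Proof. by move=> n0 i; rewrite sO_nat ltr0n. Qed.

Lemma unit_neq0 (u : O) : u \is a GRing.unit -> u != 0.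
Proof. by move=> uu; apply: contraTneq uu => ->; rewrite unitr0. Qed.

Lemma tpos_sq x : x != 0 -> tpos (x ^+ 2).
Proof.
move=> x0 i; rewrite rmorphXn /= exprn_even_gt0 //.
by rewrite -(rmorph0 (sO i)) (inj_eq (@sO_inj i)).
Qed.

Lemma nrm_sq_unit (x u : O) : u \is a GRing.unit ->
  nrm (\val (x * u ^+ 2)) = nrm (\val x).
Proof.
move=> uu; rewrite rmorphM rmorphXn /= expr2 !nrmM -expr2 -real_normK ?num_real //.
by rewrite nrm_unit // expr1n mulr1.
Qed.

Lemma nrm_sqclass (x y : O) : sqclass x y -> nrm (\val y) = nrm (\val x).
Proof. by case=> u /= uu <-; apply: nrm_sq_unit. Qed.

Lemma sqclass_sq_unit (x y u : O) : u \is a GRing.unit ->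
  sqclass x (y * u ^+ 2) -> sqclass x y.
Proof.
move=> uu [v /= vv E]; exists (v / u); first by rewrite /= unitrM vv unitrV.
by rewrite exprMn mulrA E -mulrA -exprMn divrr // expr1n mulr1.
Qed.

Lemma nrm_ge1 x : tpos x -> 1 <= nrm (\val x).
Proof.
move=> x0; have := nrm_O_gt0 x0; have [z ->] := nrm_O x.
by rewrite ltr0z -[1]/(1%:~R) ler_int.
Qed.

Lemma nrm_nat (n : nat) : nrm (\val (n%:R : O)) = n%:R ^+ d.
Proof.
rewrite /nrm -[d in RHS]card_ord -prodr_const; apply: eq_bigr => i _.
by rewrite !rmorph_nat.
Qed.

(** The form has three blocks: representatives [s0] modulo [k * D * D], the admissible elements [s1]
    with small conjugates, and [k] times the form [sk] of [large_balanced_rep]. A balanced [g] of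
    large norm is [a + k * D * l] with [a] in [s0] and [l] balanced. *)
Lemma universal_diag (al : O) : tpos al ->
  exists s : seq O,
    (forall a, a \in s ->
      [/\ tpos a, nrm (\val al) <= nrm (\val a) & ~ sqclass al a]) /\
    forall be : O, tpos be -> nrm (\val al) <= nrm (\val be) -> ~ sqclass al be ->
      diag_rep s be.
Proof.
move=> al0; have [D D0 hD] := discriminant.
have [c [C [c0 C0 hC]]] := balanced_class.
pose P be := [/\ tpos be, nrm (\val al) <= nrm (\val be) & ~ sqclass al be].
have Psq be u : u \is a GRing.unit -> P be -> P (be * u ^+ 2).
  move=> uu [p1 p2 p3]; split; first exact/tposM/tpos_sq/unit_neq0.
    by rewrite nrm_sq_unit.
  by move/(sqclass_sq_unit uu).
(* Multiplication by this [k] lifts every totally positive element above the norm of [al], hence out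
   of its class. *)
pose k := (Num.bound (nrm (\val al))).+1.
have hk : nrm (\val al) < k%:R ^+ d.
  have h : nrm (\val al) < (Num.bound (nrm (\val al)))%:R.
    exact/archi_boundP/ltW/nrm_O_gt0.
  apply: (lt_le_trans h); apply: (@le_trans _ _ k%:R); first by rewrite ler_nat.
  by rewrite -[leLHS]expr1 ler_weXn2l // ler1n.
have kP a : tpos a -> P (k%:R * a).
  move=> a0; have lt : nrm (\val al) < nrm (\val (k%:R * a)).
    have -> : nrm (\val (k%:R * a)) = k%:R ^+ d * nrm (\val a) by rewrite -nrm_nat -nrmM.
    apply: (lt_le_trans hk).
    by rewrite ler_peMr ?nrm_ge1 // exprn_ge0 // ler0n.
  split; [exact/tposM/a0/tpos_nat | exact: ltW |].
  by move/nrm_sqclass => E; rewrite E ltxx in lt.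
pose cx x := sval (cid (hD x)).
have cxE x : D%:R * x = phi (cx x) by rewrite /cx; case: cid.
have D0' : D%:R != 0 :> algR by rewrite pnatr_eq0 -lt0n.
pose i0 := Ordinal d_gt0.
have DI : injective (fun x : O => D%:R * x).
  move=> x y /(congr1 (sO i0)); rewrite !rmorphM /= sO_nat => /(mulfI D0').
  exact: sO_inj.
have cxI : injective cx by move=> x y E; apply: DI; rewrite /= !cxE E.
(* The congruence concerns the coordinates of [D * x]: one factor [D] cancels, the other stays in
   front of [l]. *)
have kDD : (0 < k * D * D)%N by rewrite !muln_gt0 D0.
have [s0 [s0P s0R]] := finite_reps_mod P cx kDD.
pose T := \sum_(a <- s0) \sum_i `|sO i a|.
have T0 : 0 <= T by apply: sumr_ge0 => a _; apply: sumr_ge0.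
have hT a i : a \in s0 -> sO i a <= T.
  move=> as0; apply: (le_trans (ler_norm _)).
  rewrite /T (big_rem a) //= (bigD1 i) //= -addrA lerDl.
  by rewrite addr_ge0 ?sumr_ge0 // => j _; rewrite sumr_ge0.
have q0 : 0 < k%:R * D%:R :> algR by rewrite mulr_gt0 // ltr0n.
have c1 : 0 < c / (2 * (k%:R * D%:R)) by rewrite divr_gt0 // mulr_gt0.
have C1 : 0 < C / (k%:R * D%:R) by rewrite divr_gt0.
have [M [sk [skP skR]]] := large_balanced_rep c1 C1 hD D0.
(* For [m >= M1] one has [2 * T <= c * m], so subtracting a representative from [g] keeps half of
   the lower bound [c * m]. *)
pose M1 := `|M| + 2 * T / c.
have M10 : 0 <= M1 by rewrite addr_ge0 // divr_ge0 ?mulr_ge0 // ltW.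
have [B B0 hB] := phi_coord_bound.
have [J _ hJ] := ler_all_bound (fun _ : 'I_d => B * (D%:R * (C * M1))).
pose Ps g := P g /\ forall i, `|sO i g| <= C * M1.
have [s1 s1P] : exists s1 : seq O, forall x, x \in s1 <-> Ps x.
  apply: (finite_bounded (J := J) cxI) => x [_ hx] i.
  rewrite -(ler_int algR) intr_norm; apply: le_trans (hJ i0); apply: hB => j.
  by rewrite -cxE rmorphM /= sO_nat normrM normr_nat ler_wpM2l ?ler0n.
exists (s0 ++ (s1 ++ [seq k%:R * a | a <- sk])); split.
  move=> a; rewrite !mem_cat => /or3P[/s0P //|/s1P[]//|/mapP[a' /skP a'0 ->]].
  exact: kP.
move=> be be0 ale nbe; have [m m0 Em] := algR_root d_gt0 (nrm_O_gt0 be0).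
have [u uu hu] := hC be m be0 m0 Em.
set g := be * u ^+ 2 in hu.
have gP : P g by apply: Psq.
suff : diag_rep (s0 ++ (s1 ++ [seq k%:R * a | a <- sk])) g.
  move=> /(diag_rep_sq (u^-1)); rewrite /g -mulrA -exprMn divrr // expr1n mulr1 //.
have [mM|mM] := leP M1 m; last first.
  rewrite -[g]add0r; apply: diag_rep_cat; first exact: diag_rep0.
  rewrite -[g]addr0; apply: diag_rep_cat; last exact: diag_rep0.
  apply: diag_rep_mem; apply/s1P; split=> // i.
  have [g0 _ _] := gP; rewrite gtr0_norm //.
  have [_ h] := andP (hu i); apply: (le_trans h).
  by rewrite ler_pM2l // ltW.
have [a as0 [e Ee]] := s0R _ gP.
have Eg : g = a + k%:R * (D%:R * phi e).
  apply: DI; rewrite /= mulrDr (cxE g) (cxE a) Ee phiD phiZ -[(k * D * D)%:~R]/((k * D * D)%:R).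
  by rewrite !natrM; ring.
rewrite Eg; apply: diag_rep_cat; first exact: diag_rep_mem.
rewrite -[_ * _]add0r; apply: diag_rep_cat; first exact: diag_rep0.
apply: diag_rep_mul; apply: (skR _ m).
  apply: le_trans mM; apply: (le_trans (ler_norm _)).
  by rewrite lerDl divr_ge0 ?mulr_ge0 // ltW.
move=> i; have := hu i.
have -> : sO i g = sO i a + k%:R * D%:R * sO i (phi e).
  by rewrite Eg rmorphD !rmorphM /= !sO_nat mulrA.
have [a0 _ _] := s0P _ as0; have := a0 i; have := hT _ i as0.
have Tm : 2 * T <= c * m.
  rewrite [c * m]mulrC -ler_pdivrMr //; apply: le_trans mM.
  by rewrite lerDr.
move=> h1 h2 h3; apply/andP; split.
  have -> : c / (2 * (k%:R * D%:R)) * m = (c * m / 2) / (k%:R * D%:R).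
    by field; rewrite ?lt0r_neq0 // ltr0n.
  by rewrite ler_pdivrMr // [leRHS]mulrC; clear -h1 h3 Tm; lra.
have -> : C / (k%:R * D%:R) * m = (C * m) / (k%:R * D%:R) by ring.
by rewrite ler_pdivlMr // [leLHS]mulrC; clear -h2 h3; lra.
Qed.

Lemma nrm_lt_add x y : tpos x -> tpos y -> nrm (\val x) < nrm (\val (x + y)).
Proof.
move=> x0 y0; apply: ltr_prod => [|i _]; first by apply/hasP; exists (Ordinal d_gt0); rewrite ?mem_index_enum.
rewrite ltW ?x0 //= rmorphD /= ltrDl; exact: y0.
Qed.

Lemma nrm_le_sq x t : tpos x -> t != 0 -> nrm (\val x) <= nrm (\val (x * t ^+ 2)).
Proof.
move=> x0 t0.
have -> : nrm (\val (x * t ^+ 2)) = nrm (\val x) * nrm (\val (t ^+ 2)) by rewrite -nrmM.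
by rewrite ler_peMr ?nrm_ge1 ?ltW ?nrm_O_gt0 //; exact: tpos_sq.
Qed.

(** The norm [z] of [t] has square 1, so [z] times the integral quotient [z / t] is an inverse of
    [t]. *)
Lemma nrm_eq_sq x t : tpos x -> nrm (\val (x * t ^+ 2)) = nrm (\val x) ->
  t \is a GRing.unit.
Proof.
move=> x0.
have -> : nrm (\val (x * t ^+ 2)) = nrm (\val x) * nrm (\val t) ^+ 2 by rewrite !expr2 -!nrmM.
have n0 : nrm (\val x) != 0 by rewrite gt_eqF ?nrm_O_gt0.
rewrite -[RHS]mulr1 => /(mulfI n0); have [z Ez] := nrm_O t.
rewrite Ez -rmorphXn -[1]/(1%:~R) => /intr_inj z2.
have tn0 : t != 0.
  apply: contraTneq isT => tE; move: Ez; rewrite tE.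
  have /eqP -> : nrm (\val (0 : O)) == 0 by rewrite nrm_eq0.
  by move=> /esym/eqP; rewrite intr_eq0 => /eqP z0; move: z2; rewrite z0.
have iz := cofactor_integral tn0 Ez.
have v0 : int_val t != 0 by rewrite (raddf_eq0 _ val_inj).
apply/unitrPr; exists (z%:~R * Integers iz); apply: val_inj.
transitivity (int_val t * (z%:~R * (z%:~R / int_val t))).
  by congr (_ * _); congr (_ * _); exact: val_intr.
rewrite mulrCA (_ : int_val t * _ = z%:~R); last by rewrite mulrC divfK.
by rewrite -rmorphM -expr2 z2.
Qed.

End Balancing.

(** * Lattices *)

(** All that the lattice argument needs, free of embeddings. [N] is the absolute value of the norm,
    valued in [nat] so that an element of least norm can be picked. *)
Lemma totally_real_norm (K : fieldExtType rat) (hK : totally_real K) :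
  exists N : integers K -> nat,
  [/\ forall x y, totally_positive x -> totally_positive y -> (N x < N (x + y)%R)%N,
      forall x t, totally_positive x -> t != 0 -> (N x <= N (x * t ^+ 2)%R)%N,
      forall x t, totally_positive x -> t != 0 -> N (x * t ^+ 2) = N x ->
        t \is a GRing.unit
    & forall al, totally_positive al -> exists s : seq (integers K),
        (forall a, a \in s ->
           [/\ totally_positive a, (N al <= N a)%N & ~ sqclass al a]) /\
        forall be, totally_positive be -> (N al <= N be)%N -> ~ sqclass al be ->
          diag_rep s be].
Proof.
have [d [sg [b [d0 sg_all b_int Wu b_gen]]]] := real_embeddings hK.
have tposE x : totally_positive x <-> tpos sg x.
  split=> [h i|h s]; first exact: (h (algRval \o sg i)).
  by have [i ->] := sg_all s; exact: (h i).
have Nex x := nrm_O Wu b_gen x.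
pose N x := `|sval (cid (Nex x))|%N.
have NE x : tpos sg x -> nrm sg (\val x) = (N x)%:R.
  move=> /(nrm_O_gt0); rewrite /N; case: cid => z /= -> z0.
  by rewrite -[RHS]/((`|z|%N%:Z)%:~R) gez0_abs // -(ler0z algR) ltW.
have Nlt x y : tpos sg x -> tpos sg y ->
    (nrm sg (\val x) < nrm sg (\val y)) = (N x < N y)%N.
  by move=> x0 y0; rewrite !NE // ltr_nat.
have Nle x y : tpos sg x -> tpos sg y ->
    (nrm sg (\val x) <= nrm sg (\val y)) = (N x <= N y)%N.
  by move=> x0 y0; rewrite !NE // ler_nat.
have tposD x y : tpos sg x -> tpos sg y -> tpos sg (x + y).
  by move=> x0 y0 i; rewrite rmorphD; apply: addr_gt0; [apply: x0|apply: y0].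
exists N; split.
- move=> x y /tposE x0 /tposE y0; rewrite -Nlt //; last exact: tposD.
  exact: nrm_lt_add.
- move=> x t /tposE x0 t0; rewrite -Nle //; first exact: (nrm_le_sq Wu b_gen).
  exact/tposM/tpos_sq.
- move=> x t /tposE x0 t0 E; apply: (nrm_eq_sq d0 Wu b_gen x0).
  by rewrite !NE ?E //; exact/tposM/tpos_sq.
- move=> al /tposE al0; have [s [sP sR]] := universal_diag d0 b_int Wu b_gen al0.
  exists s; split=> [a /sP[a0 ale na]|be /tposE be0 ale nbe].
    by split=> //; [exact/tposE | rewrite -Nle].
  by apply: sR => //; rewrite Nle.
Qed.

Section Lattices.
Variable K : fieldExtType rat.
Local Notation O := (integers K).

Section OrthogonalSum.
Variables L M : lattice K.

Definition osum_Q (x : (L * M)%type) : O := lat_Q x.1 + lat_Q x.2.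

Lemma osum_polar x y : polar osum_Q x y =
  polar (@lat_Q K L) x.1 y.1 + polar (@lat_Q K M) x.2 y.2.
Proof. by rewrite /polar /osum_Q /=; ring. Qed.

Lemma osum_fg : finitely_generated (L * M)%type.
Proof.
have [m [e he]] := lat_fg L; have [n [f hf]] := lat_fg M.
exists (m + n)%N, (fun i => match split i with inl j => (e j, 0) | inr j => (0, f j) end).
move=> [v w]; have [c Ec] := he v; have [c' Ec'] := hf w.
exists (fun i => match split i with inl j => c j | inr j => c' j end).
have l (i : 'I_m) : split (lshift n i) = inl i := unsplitK (inl i).
have r (i : 'I_n) : split (rshift m i) = inr i := unsplitK (inr i).
rewrite [RHS]surjective_pairing; congr (_, _).
  rewrite (raddf_sum fst) big_split_ord /= [X in _ + X]big1 ?addr0.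
    by rewrite Ec; apply: eq_bigr => i _; rewrite l.
  by move=> i _; rewrite r /= scaler0.
rewrite (raddf_sum snd) big_split_ord /= big1 ?add0r.
  by rewrite Ec'; apply: eq_bigr => i _; rewrite r.
by move=> i _; rewrite l /= scaler0.
Qed.

Lemma osum_torsion_free : torsion_free (L * M)%type.
Proof.
move=> a [v w] [] /lat_torsion_free[->|->]; first by left.
by case/lat_torsion_free => ->; [left|right].
Qed.

Lemma osum_QZ a x : osum_Q (a *: x) = a ^+ 2 * osum_Q x.
Proof. by rewrite /osum_Q !lat_QZ mulrDr. Qed.

Lemma osum_bilinear : bilinear_for (\val \; *%R) (\val \; *%R) (polar osum_Q).
Proof.
have [hL1 hL2] := lat_bilinear L; have [hM1 hM2] := lat_bilinear M.
split=> z a x y; rewrite !osum_polar /=.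
  by rewrite (hL1 z.1) (hM1 z.2) /= mulrDr addrACA.
by rewrite (hL2 z.1) (hM2 z.2) /= mulrDr addrACA.
Qed.

Lemma lat_Q0 (N : lattice K) : lat_Q (0 : N) = 0.
Proof. by rewrite -(scale0r (0 : N)) lat_QZ expr0n mul0r. Qed.

Lemma totally_positiveD (x y : O) :
  totally_positive x -> totally_positive y -> totally_positive (x + y).
Proof. by move=> x0 y0 s; rewrite !rmorphD addr_gt0. Qed.

Lemma osum_pos x : x != 0 -> totally_positive (osum_Q x).
Proof.
case: x => v w; rewrite /osum_Q /=.
have [->|v0] := eqVneq v 0; have [->|w0] := eqVneq w 0.
- by rewrite eqxx.
- by rewrite lat_Q0 add0r => _; apply: lat_pos.
- by rewrite lat_Q0 addr0 => _; apply: lat_pos.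
- by move=> _; apply: totally_positiveD; apply: lat_pos.
Qed.

Definition osum : lattice K :=
  Lattice osum_fg osum_torsion_free osum_QZ osum_bilinear osum_pos.

Lemma X_lattice_osum X : X_lattice X L -> X_lattice X M -> X_lattice X osum.
Proof. by case: X => //= hL hM v w; rewrite osum_polar rpredD. Qed.

Lemma represents_osuml a : represents L a -> represents osum a.
Proof. by case=> v <-; exists (v, 0); rewrite /= /osum_Q lat_Q0 addr0. Qed.

Lemma represents_osumr a : represents M a -> represents osum a.
Proof. by case=> v <-; exists (0, v); rewrite /= /osum_Q lat_Q0 add0r. Qed.

End OrthogonalSum.

Section Diagonal.
Variable s : seq O.
Hypothesis s_pos : forall a, a \in s -> totally_positive a.

Definition diag_Q (v : 'rV[O]_(size s)) : O := \sum_(i < size s) s`_i * v 0 i ^+ 2.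

(** The 2 produced by polarization cancels the denominator, so diagonal lattices are classical. *)
Lemma diag_polar v w : polar diag_Q v w = \val (\sum_(i < size s) s`_i * v 0 i * w 0 i).
Proof.
have two : 2 != 0 :> K by rewrite -(rmorph_nat (in_alg K)) fmorph_eq0.
have E : diag_Q (v + w) - diag_Q v - diag_Q w =
    (\sum_(i < size s) s`_i * v 0 i * w 0 i) *+ 2.
  by rewrite /diag_Q -!sumrB -sumrMnl; apply: eq_bigr => i _; rewrite mxE; ring.
by rewrite /polar -!rmorphB E rmorphMn -[_ *+ 2]mulr_natr mulfK.
Qed.

Lemma diag_fg : finitely_generated 'rV[O]_(size s).
Proof.
exists (size s), (fun i => delta_mx 0 i) => v; exists (fun i => v 0 i).
exact: row_sum_delta.
Qed.

Lemma diag_torsion_free : torsion_free 'rV[O]_(size s).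
Proof.
move=> a v av; have [->|a0] := eqVneq a 0; [by left|right].
apply/rowP => i; rewrite mxE; move/rowP/(_ i): av; rewrite !mxE.
move=> /(congr1 \val); rewrite !rmorphM rmorph0 /= => /eqP; rewrite mulf_eq0.
rewrite (raddf_eq0 _ val_inj) (negPf a0) (raddf_eq0 _ val_inj) => /eqP //.
Qed.

Lemma diag_Q0 : diag_Q 0 = 0.
Proof. by apply: big1 => i _; rewrite mxE expr0n mulr0. Qed.

Lemma diag_QZ a v : diag_Q (a *: v) = a ^+ 2 * diag_Q v.
Proof. by rewrite mulr_sumr; apply: eq_bigr => i _; rewrite mxE; ring. Qed.

Lemma diag_bilinear : bilinear_for (\val \; *%R) (\val \; *%R) (polar diag_Q).
Proof.
split=> z a x y; rewrite !diag_polar; set S1 := (X in \val X); set S2 := (X in _ + \val X).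
  have -> : S1 = a * (\sum_(i < size s) s`_i * x 0 i * z 0 i) + S2.
    by rewrite mulr_sumr -big_split; apply: eq_bigr => i _; rewrite !mxE /=; ring.
  by rewrite rmorphD rmorphM.
have -> : S1 = a * (\sum_(i < size s) s`_i * z 0 i * x 0 i) + S2.
  by rewrite mulr_sumr -big_split; apply: eq_bigr => i _; rewrite !mxE /=; ring.
by rewrite rmorphD rmorphM.
Qed.

Lemma totally_positive_sq (t : O) : totally_real K -> t != 0 ->
  totally_positive (t ^+ 2).
Proof.
move=> hK t0 r; have -> : r (\val (t ^+ 2)) = r (\val t) ^+ 2 by rewrite !rmorphXn.
rewrite lt0r real_exprn_even_ge0 ?hK // andbT.
by rewrite expf_neq0 // fmorph_eq0 (raddf_eq0 _ val_inj).
Qed.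

Hypothesis hK : totally_real K.

Lemma totally_positive_mul_sq (a t : O) : totally_positive a -> t != 0 ->
  totally_positive (a * t ^+ 2).
Proof.
move=> a0 t0 r; have -> : r (\val (a * t ^+ 2)) = r (\val a) * r (\val (t ^+ 2)).
  by rewrite !rmorphM.
by apply: mulr_gt0; [exact: a0|exact: totally_positive_sq].
Qed.

(** Isolating one nonzero coordinate allows the norm of a value to be compared with that of a
    coefficient. *)
Lemma diag_Q_split (v : 'rV[O]_(size s)) : v != 0 ->
  exists a t x, [/\ a \in s, t != 0, diag_Q v = a * t ^+ 2 + x
    & x = 0 \/ totally_positive x].
Proof.
move=> /matrix0Pn[z [i]]; rewrite ord1 => vi.
exists s`_i, (v 0 i), (\sum_(j < size s | j != i) s`_j * v 0 j ^+ 2).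
split=> //; [exact: mem_nth | by rewrite /diag_Q (bigD1 i) |].
apply: (big_ind (fun x => x = 0 \/ totally_positive x)); first by left.
  move=> x y [->|x0] [->|y0]; rewrite ?add0r ?addr0; try by [left|right].
  by right; exact: totally_positiveD.
move=> j _; have [->|vj] := eqVneq (v 0 j) 0; first by left; rewrite expr0n mulr0.
by right; apply: totally_positive_mul_sq => //; apply/s_pos/mem_nth.
Qed.

Lemma diag_pos v : v != 0 -> totally_positive (diag_Q v).
Proof.
move=> /diag_Q_split[a [t [x [/s_pos a0 t0 -> x0]]]].
have at0 := totally_positive_mul_sq a0 t0.
by case: x0 => [->|x0]; rewrite ?addr0 //; apply: totally_positiveD.
Qed.

Definition diag : lattice K :=
  Lattice diag_fg diag_torsion_free diag_QZ diag_bilinear diag_pos.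

Lemma X_lattice_diag X : X_lattice X diag.
Proof. by case: X => //= v w; rewrite diag_polar int_valP. Qed.

Lemma represents_diag a : diag_rep s a -> represents diag a.
Proof.
move=> /diag_repE[v ->]; exists (\row_i v i); rewrite /= /diag_Q.
by apply: eq_bigr => i _; rewrite mxE.
Qed.

End Diagonal.

Lemma sqclass_refl (a : O) : sqclass a a.
Proof. by exists 1; rewrite /= ?unitr1 // expr1n mulr1. Qed.

Lemma sqclass_eqP (a c : O) : sqclass a c <-> sqclass a = sqclass c.
Proof.
split=> [[u /= uu <-]|->]; last exact: sqclass_refl.
rewrite eqEsubset; split=> x [w /= wu <-].
  exists (u^-1 * w); first by rewrite /= unitrM unitrV uu.
  by rewrite exprMn mulrA -[a * _ * _]mulrA -exprMn divrr // expr1n mulr1.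
by exists (u * w); rewrite /= ?unitrM ?uu // exprMn mulrA.
Qed.

Lemma represents_sqclass (L : lattice K) (a c : O) :
  sqclass a c -> represents L a -> represents L c.
Proof. by case=> u _ <- [v <-]; exists (u *: v); rewrite lat_QZ mulrC. Qed.

End Lattices.

(** [M] is the diagonal lattice of [universal_diag]. If [osum L M] represents [al] with a nonzero
    component in [M], then [al = a * t ^+ 2 + y] for a coefficient [a]. A nonzero [y] would make the
    norm of [al] exceed that of [a]; if [y = 0], equal norms force [t] to be a unit and put [a] in
    the excluded class. *)
Lemma avoiding_lattice (K : fieldExtType rat) (hK : totally_real K) :
  exists N : integers K -> nat,
    (forall a t x, totally_positive a -> t != 0 -> x = 0 \/ totally_positive x ->
       (N a <= N (a * t ^+ 2 + x)%R)%N) /\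
    forall al, totally_positive al -> exists M : lattice K,
      [/\ forall X, X_lattice X M,
          forall L, ~ represents L al -> ~ represents (osum L M) al
        & forall be, totally_positive be -> (N al <= N be)%N ->
            sqclass be <> sqclass al -> represents M be].
Proof.
have [N [Nlt Nle Neq Nex]] := totally_real_norm hK.
exists N; split=> [a t x a0 t0 [->|x0]|al al0]; first by rewrite addr0 Nle.
  apply: leq_trans (Nle a t a0 t0) (ltnW (Nlt _ _ _ x0)).
  exact: totally_positive_mul_sq.
have [s [sP sR]] := Nex al al0.
have s0 a : a \in s -> totally_positive a by case/sP.
exists (diag s0 hK); split=> [X|L nL [[v w] /= Evw]|be be0 ale nbe].
- exact: X_lattice_diag.
- have [w0|w0] := eqVneq w 0.
    apply: nL; exists v; move: Evw.
    by rewrite /osum_Q /= w0 diag_Q0 addr0.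
  have [a [t [x [/sP[a0 ale na] t0 Ew x0]]]] := diag_Q_split s0 hK w0.
  have {}Evw : al = a * t ^+ 2 + (x + lat_Q v).
    by rewrite -Evw /osum_Q /= Ew addrC addrA.
  have at0 := totally_positive_mul_sq hK a0 t0.
  have [y0|y0] : x + lat_Q v = 0 \/ totally_positive (x + lat_Q v).
    have [->|v0] := eqVneq v 0; first by rewrite lat_Q0 addr0.
    right; have Qv := lat_pos v0.
    by case: x0 => [->|x0]; rewrite ?add0r //; apply: totally_positiveD.
  + rewrite y0 addr0 in Evw; apply: na.
    have tu : t \is a GRing.unit.
      by apply: (Neq a) => //; apply/eqP; rewrite eqn_leq Nle // andbT -Evw.
    exists t^-1; first by rewrite /= unitrV.
    by rewrite Evw -mulrA -exprMn divrr // expr1n mulr1.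
  + have := Nlt _ _ at0 y0; rewrite -Evw ltnNge => /negP; apply.
    by apply: leq_trans ale _; apply: Nle.
- by apply/represents_diag/sR => // /sqclass_eqP /esym.
Qed.

(** * Critical classes and criterion sets *)

Theorem theorem5p2 (K : fieldExtType rat) (hK : totally_real K)
    (S : set (set (integers K))) (hS : S `<=` @positive_classes K)
    (X : lattice_kind) :
  (forall C : set (set (integers K)), C `<=` @positive_classes K ->
     gen_criterion_set S X C -> critical S X `<=` C) /\
  (min_gen_criterion_set S X (critical S X) /\
   forall C : set (set (integers K)),
     min_gen_criterion_set S X C -> C = critical S X).
Proof.
have [N [Nle Nex]] := avoiding_lattice hK.
have crit_sub C : gen_criterion_set S X C -> critical S X `<=` C.
  move=> [_ Ccrit] c [Sc [a [a0 Ea [L [XL nLa uL]]]]]; apply: contrapT => nCc.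
  have [M [XM LM MR]] := Nex a a0.
  have s0 b : b \in [:: a] -> totally_positive b by rewrite inE => /eqP ->.
  pose A := diag s0 hK.
  (* [L] misses only the class of [a] in [S], and [A] represents it. *)
  have uLA : universal C (osum L A).
    apply/Ccrit; first exact/X_lattice_osum/X_lattice_diag.
    move=> b b0 Sb; have [Eb|nb] := pselect (sqclass b = c).
      apply/represents_osumr/(@represents_sqclass _ _ a).
        by apply/sqclass_eqP; rewrite Ea Eb.
      by apply/represents_diag/diag_rep_mem; rewrite inE.
    by apply/represents_osuml/uL.
  apply: (LM L nLa); suff uLM : universal S (osum L M) by apply: uLM; rewrite // Ea.
  apply/Ccrit; first exact: X_lattice_osum.
  move=> b b0 Cb; have [Lb|nLb] := pselect (represents L b).
    exact: represents_osuml.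
  apply: represents_osumr; apply: MR => //; last by rewrite Ea => Eb; rewrite Eb in Cb.
  (* As [L] misses [b], the component [w] in [A] is nonzero, whence [N a <= N b]. *)
  have [[v w] /= Evw] := uLA b b0 Cb.
  have [w0|w0] := eqVneq w 0.
    by case: nLb; exists v; rewrite -Evw /osum_Q /= w0 diag_Q0 addr0.
  have [a' [t [x [a's t0 Ew x0]]]] := diag_Q_split s0 hK w0.
  have -> : b = a * t ^+ 2 + (x + lat_Q v).
    by move: a's; rewrite inE -Evw /osum_Q /= Ew => /eqP ->; rewrite addrC addrA.
  apply: Nle => //; have [->|v0] := eqVneq v 0; first by rewrite lat_Q0 addr0.
  right; have Qv := lat_pos v0.
  by case: x0 => [->|x0]; rewrite ?add0r //; apply: totally_positiveD.
have crit : gen_criterion_set S X (critical S X).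
  split=> [c [/hS] //|L XL]; split=> [uL b b0 [Sb _]|uL]; first exact: uL.
  apply: contrapT => nuL.
  pose P n := `[< exists a,
    [/\ totally_positive a, S (sqclass a), ~ represents L a & N a = n] >].
  have exP : exists n, P n.
    apply: contrapT => nP; apply: nuL => a a0 Sa; apply: contrapT => nLa.
    by apply: nP; exists (N a); apply/asboolP; exists a.
  have [n /asboolP[a [a0 Sa nLa Na]] nmin] := ex_minnP exP.
  (* A missed class of least norm is critical by way of [osum L M]: any other class of [S] that [L]
     misses has norm at least [N a], so [M] represents it. *)
  apply: (nLa); apply: uL => //; split=> //; exists a; split=> //.
  have [M [XM LM MR]] := Nex a a0.
  exists (osum L M); split; [exact: X_lattice_osum | exact: (LM L nLa) |].
  move=> b b0 [Sb nb]; have [Lb|nLb] := pselect (represents L b).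
    exact: represents_osuml.
  apply: represents_osumr; apply: MR => //.
  by rewrite Na; apply: nmin; apply/asboolP; exists b.
split=> [C _|]; first exact: crit_sub.
(* The critical classes lie in every criterion set, which gives both minimality and uniqueness. *)
split=> [|C [Ccrit Cmin]].
  by split=> // D Dcrit DC; rewrite eqEsubset; split=> //; exact: crit_sub.
by apply/esym/Cmin => //; exact: crit_sub.
Qed.
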